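(* There is an algorithm that, given any tree $T$ on $n$ vertices, constructs in $O(n)$ time a rectangular layout of $T$ on the integer grid of area $O(n\log n)$.
   Context: A (strong) rectangular layout of a graph $G=(V,E)$ is a set of axis-parallel rectangles with pairwise disjoint interiors, in bijection with $V$, such that two rectangles' boundaries share a segment of positive length if and only if the corresponding vertices are adjacent. On the integer grid all rectangle corners have integer coordinates; the area of a layout is the area of its smallest enclosing axis-parallel bounding box. *)

(* Defs.v *)
From HB Require Import structures.
From mathcomp Require Import all_boot all_order all_algebra.
From mathcomp Require Import reals.

Set Implicit Arguments.
Unset Strict Implicit.
Unset Printing Implicit Defensive.

Import Order.TTheory GRing.Theory Num.Theory.

(** * Trees *)

Definition is_tree (T : finType) (e : rel T) : Prop :=
  [/\ 0 < #|T|,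
      symmetric e,
      irreflexive e,
      forall u v : T, connect e u v
    & forall c : seq T, ucycle e c -> size c <= 2].

(** [es] lists every edge exactly once, in any order and with any orientation. *)
Definition is_edge_list (T : finType) (e : rel T) (es : seq (T * T)) : Prop :=
  let edges := [seq [set p.1; p.2] | p <- es] in
  uniq edges /\ (forall u v : T, e u v <-> [set u; v] \in edges).

(** * Rectangular layouts in the plane [R * R] *)

Section Geometry.
Local Open Scope ring_scope.
Variable R : realType.

Record rect := Rect { xmin : R; ymin : R; xmax : R; ymax : R }.

Definition rect_valid (r : rect) : bool := (xmin r < xmax r) && (ymin r < ymax r).

Definition in_rect (r : rect) (z : R * R) : bool :=
  (xmin r <= z.1 <= xmax r) && (ymin r <= z.2 <= ymax r).

Definition in_interior (r : rect) (z : R * R) : bool :=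
  (xmin r < z.1 < xmax r) && (ymin r < z.2 < ymax r).

Definition in_boundary (r : rect) (z : R * R) : bool :=
  in_rect r z && ~~ in_interior r z.

Definition in_segment (p q z : R * R) : Prop :=
  exists2 t : R, 0 <= t <= 1
    & z = ((1 - t) * p.1 + t * q.1, (1 - t) * p.2 + t * q.2).

(** The boundaries share a segment of positive length. *)
Definition contact (r s : rect) : Prop :=
  exists p q : R * R,
    p <> q /\
    (forall z, in_segment p q z -> in_boundary r z /\ in_boundary s z).

Definition rectangular_layout (T : finType) (e : rel T) (L : T -> rect) : Prop :=
  [/\ forall v, rect_valid (L v),
      forall u v, u <> v ->
        forall z, ~ (in_interior (L u) z /\ in_interior (L v) z)
    & forall u v, u <> v -> (contact (L u) (L v) <-> e u v)].

Definition on_integer_grid (T : finType) (L : T -> rect) : Prop :=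
  forall v, [/\ xmin (L v) \is a Num.int, ymin (L v) \is a Num.int,
                xmax (L v) \is a Num.int & ymax (L v) \is a Num.int].

Definition encloses (T : finType) (b : rect) (L : T -> rect) : Prop :=
  forall v z, in_rect (L v) z -> in_rect b z.

Definition smallest_bounding_box (T : finType) (L : T -> rect) (b : rect) : Prop :=
  encloses b L /\
  (forall b', encloses b' L -> forall z, in_rect b z -> in_rect b' z).

Definition rect_area (r : rect) : R := (xmax r - xmin r) * (ymax r - ymin r).

Definition layout_area_le (T : finType) (L : T -> rect) (a : R) : Prop :=
  exists2 b, rect_valid b /\ smallest_bounding_box L b & rect_area b <= a.

End Geometry.

(** * Word RAM programs

    A unit-cost random access machine with structured control flow.  The
    machine has registers and a flat memory, both holding natural numbers
    smaller than the word bound [B]; a computation producing a value that is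
    not smaller than [B] is stuck, i.e. has no execution.  Subtraction is
    truncated; there is no multiplication, division or bit operation. *)

Inductive expr :=
| EConst of nat
| EReg of nat
| ELoad of expr
| EAdd of expr & expr
| ESub of expr & expr.

Inductive cmd :=
| CSkip
| CSet of nat & expr
| CStore of expr & expr
| CSeq of cmd & cmd
| CIfLt of expr & expr & cmd & cmd
| CWhileLt of expr & expr & cmd.

Record state := State { reg : nat -> nat; mem : nat -> nat }.

Definition upd (f : nat -> nat) (i x : nat) : nat -> nat :=
  fun j => if j == i then x else f j.

Definition word (B x : nat) : option nat := if x < B then Some x else None.

Fixpoint eval (B : nat) (s : state) (a : expr) : option nat :=
  match a with
  | EConst k => word B k
  | EReg r => word B (reg s r)
  | ELoad a1 => if eval B s a1 is Some i then word B (mem s i) else None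
  | EAdd a1 a2 =>
      match eval B s a1, eval B s a2 with
      | Some x, Some y => word B (x + y)
      | _, _ => None
      end
  | ESub a1 a2 =>
      match eval B s a1, eval B s a2 with
      | Some x, Some y => word B (x - y)
      | _, _ => None
      end
  end.

Fixpoint ecost (a : expr) : nat :=
  match a with
  | EConst _ | EReg _ => 1
  | ELoad a1 => (ecost a1).+1
  | EAdd a1 a2 | ESub a1 a2 => (ecost a1 + ecost a2).+1
  end.

(** [exec B c s t s']: with word bound [B], the program [c] started in [s]
    halts in [s'] after [t] elementary operations. *)
Inductive exec (B : nat) : cmd -> state -> nat -> state -> Prop :=
| ExSkip s : exec B CSkip s 1 s
| ExSet s r a x :
    eval B s a = Some x ->
    exec B (CSet r a) s (ecost a).+1 (State (upd (reg s) r x) (mem s))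
| ExStore s a1 a2 i x :
    eval B s a1 = Some i -> eval B s a2 = Some x ->
    exec B (CStore a1 a2) s (ecost a1 + ecost a2).+1
      (State (reg s) (upd (mem s) i x))
| ExSeq s1 s2 s3 c1 c2 t1 t2 :
    exec B c1 s1 t1 s2 -> exec B c2 s2 t2 s3 ->
    exec B (CSeq c1 c2) s1 (t1 + t2) s3
| ExIf s s' a1 a2 c1 c2 x y t :
    eval B s a1 = Some x -> eval B s a2 = Some y ->
    exec B (if x < y then c1 else c2) s t s' ->
    exec B (CIfLt a1 a2 c1 c2) s ((ecost a1 + ecost a2).+1 + t) s'
| ExWhileEnd s a1 a2 c x y :
    eval B s a1 = Some x -> eval B s a2 = Some y -> ~~ (x < y) ->
    exec B (CWhileLt a1 a2 c) s (ecost a1 + ecost a2).+1 s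
| ExWhileStep s1 s2 s3 a1 a2 c x y t1 t2 :
    eval B s1 a1 = Some x -> eval B s1 a2 = Some y -> x < y ->
    exec B c s1 t1 s2 -> exec B (CWhileLt a1 a2 c) s2 t2 s3 ->
    exec B (CWhileLt a1 a2 c) s1 ((ecost a1 + ecost a2).+1 + (t1 + t2)) s3.

(** * Input and output conventions *)

(** Register 0 holds [n], cells [2 i] and [2 i + 1] hold the endpoints of the
    [i]-th edge, and everything else is zero. *)
Definition input_state (n : nat) (es : seq ('I_n * 'I_n)) : state :=
  State (upd (fun=> 0) 0 n)
        (nth 0 (flatten [seq [:: val p.1; val p.2] | p <- es])).

(** Cells [4 v], ..., [4 v + 3] hold the coordinates of the rectangle of [v]. *)
Definition output_layout (R : realType) (n : nat) (s : state) : 'I_n -> rect R :=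
  fun v => Rect (mem s (4 * v))%:R (mem s (4 * v + 1))%:R
                (mem s (4 * v + 2))%:R (mem s (4 * v + 3))%:R.

(* Main.v *)
Require Import Defs.
From HB Require Import structures.
From mathcomp Require Import all_boot all_order all_algebra.
From mathcomp Require Import reals boolp zify lra.
Import Defs.

Set Implicit Arguments.
Unset Strict Implicit.
Unset Printing Implicit Defensive.

Import Order.TTheory GRing.Theory Num.Theory.

(** Heavy-path layout.  Root the tree and let every inner vertex choose a child
    with the largest subtree as its heavy child.  The vertices of a heavy path
    are placed side by side in one row, and the subtrees of the light children
    of a vertex hang below it.  Only the first vertex of a path reaches up to
    its parent; the others start one unit lower, so they do not touch it.  The
    width is linear in [n].  A light child has at most half the size of its
    parent, so a vertex has at most about [log2 n] light ancestors, and the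
    height is logarithmic.

    The program needs no adjacency lists.  For every vertex it stores the degree
    and the sum of the names of its neighbours.  When leaves are pruned one after
    the other, the sum stored at the current leaf is its parent.  The pruning
    order serves to compute the subtree sizes and, read backwards, the
    coordinates.  The extra vertex [n] is a virtual parent of vertex 0, which
    removes the special treatment of the root. *)

(** * Rooting a tree at an extra vertex *)

(** Contact must hold for edges only, so nonadjacent rectangles are kept strictly apart, and every
    gap costs area. Vertex [v] owns an interval of length [S v], twice the size of its subtree, and
    two such intervals are nested or meet at most in an end point. The rectangle of [v] leaves free
    the last [b v] units of its interval: the interval of the heavy child, or one unit at a leaf. As
    [b v] is at least 1, consecutive intervals never give touching rectangles. The factor 2 comes
    from the leaves: one unit for the rectangle, one for the gap.

    The input has arbitrary order and orientation. It enters only through symmetric sums over the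
    edges, which are rewritten as sums over the pairs of a vertex and its parent.

    The machine is stuck on overflow, so correctness includes a polynomial bound on every word at
    every moment. Partial widths are bounded by a conserved quantity: pruning moves the width of a
    vertex to its parent and keeps the total over the open vertices. The neighbour sums are
    quadratic in [n]. *)

Record rooted (n : nat) (par dep : nat -> nat) : Prop := Rooted {
  par_le : forall v, v < n -> par v <= n;
  par_eq_top : forall v, v < n -> (par v == n) = (v == 0);
  dep_par : forall v, v < n -> dep (par v) < dep v }.

Section TreeRooting.
Variables (T : finType) (e : rel T) (r : T).
Hypothesis tree_e : is_tree e.

(** Boolean, with the length as a parameter, so that [ex_minn] can define the distance. *)
Definition reach_in (k : nat) (v : T) : bool :=
  [exists p : k.-tuple T, path e r p && (last r p == v)].

Lemma reach_inP k v :
  reflect (exists p, [/\ path e r p, last r p = v & size p = k]) (reach_in k v).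
Proof.
apply: (iffP existsP) => [[p /andP[pp /eqP lp]]|[p [pp lp sp]]].
  by exists p; rewrite size_tuple.
by exists (Tuple (introT eqP sp)); rewrite /= pp lp eqxx.
Qed.

Lemma ex_reach v : exists k, reach_in k v.
Proof.
case: tree_e => _ _ _ conn _; case/connectP: (conn r v) => p pp ->.
by exists (size p); apply/reach_inP; exists p.
Qed.

Definition dist v := ex_minn (ex_reach v).

Lemma dist_path v : exists p, [/\ path e r p, last r p = v & size p = dist v].
Proof. by rewrite /dist; case: ex_minnP => k /reach_inP. Qed.

Lemma dist_le p : path e r p -> dist (last r p) <= size p.
Proof.
move=> pp; rewrite /dist; case: ex_minnP => k _; apply.
by apply/reach_inP; exists p.
Qed.

Lemma dist_parent v : v != r -> exists2 u, e u v & dist u < dist v.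
Proof.
move=> vr; case: (dist_path v) => p [pp lp sp].
case/lastP: p pp lp sp => [|p x]; first by move=> _ /= rv; rewrite rv eqxx in vr.
rewrite rcons_path last_rcons size_rcons => /andP[pp ex] xv <-.
by exists (last r p); [rewrite -xv | exact: dist_le].
Qed.

Lemma dist_mem p u v :
  path e r p -> last r p = u -> size p = dist u -> v \in r :: p -> v != u ->
  dist v < dist u.
Proof.
move=> pp lp sp; rewrite -lp => /splitPl vp; case: vp pp lp sp => p1 p2 lp1.
rewrite cat_path last_cat lp1 => /andP[p1p p2p] <-; rewrite size_cat => <- vu.
have := dist_le p1p; rewrite lp1 => h; apply: leq_ltn_trans h _.
by case: p2 vu {p2p} => [|a p2]; rewrite /= ?eqxx // addnS ltnS leq_addr.
Qed.

(* Two such neighbours would be joined by a path avoiding [v], closing a cycle. *)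
Lemma lower_neighbour_unique v u1 u2 :
  e u1 v -> e u2 v -> dist u1 <= dist v -> dist u2 <= dist v -> u1 = u2.
Proof.
case: (tree_e) => _ sym irr _ acyc e1 e2 d1 d2; apply/eqP/negPn/negP => u12.
pose f := [rel x y | [&& e x y, x != v & y != v]].
have symf : connect_sym f.
  by apply: sym_connect_sym => x y; rewrite /= sym; case: (e y x) => //=; rewrite andbC.
(* A shortest path to [u] avoids [v]: its vertices other than [u] are strictly closer to [r] than
   [u], hence than [v]. *)
have key u : e u v -> dist u <= dist v -> connect f r u.
  move=> euv du; case: (dist_path u) => p [pp lp sp].
  have vp : v \notin r :: p.
    apply/negP => vin; have vu : v != u.
      by apply/eqP => vu; rewrite vu irr in euv.
    by have := dist_mem pp lp sp vin vu; rewrite ltnNge du.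
  apply/connectP; exists p; last by rewrite lp.
  elim: p (r) pp vp {lp sp} => //= x p IH y /andP[eyx pp].
  rewrite !inE !negb_or => /and3P[yv xv vp].
  by rewrite eyx eq_sym yv eq_sym xv /= IH // inE negb_or xv.
have : connect f u1 u2.
  by apply: (@connect_trans _ _ r); [rewrite symf; exact: key | exact: key].
case/connectP => p0 pp0 lp0; case: (shortenP pp0) lp0 => p pp up _ lp.
have ep : path e u1 p.
  by apply: sub_path pp => x y /= /and3P[].
have vp : v \notin u1 :: p.
  have vu1 : v != u1 by apply/eqP => vu; rewrite vu irr in e1.
  rewrite inE negb_or vu1 /=.
  elim: p (u1) pp {up lp ep} => //= x p IH y /andP[/and3P[_ _ xv] pp].
  by rewrite inE negb_or eq_sym xv /= (IH x).
have /acyc : ucycle e (v :: u1 :: p).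
  rewrite /ucycle /= rcons_path ep -lp e2 sym e1 /=.
  by move: up; rewrite /= => ->; rewrite vp.
by case: p lp {pp up ep vp} => [|x p] //= lp; rewrite lp eqxx in u12.
Qed.

(** If [u] were not the root, a lower neighbour of [u] and [v] itself would both be neighbours of
    [u] at distance at most [dist u], hence equal, which is absurd. By symmetry both ends would be
    the root. This uses the non-strict inequalities of [lower_neighbour_unique]. *)
Lemma adjacent_dist u v : e u v -> dist u != dist v.
Proof.
case: (tree_e) => _ sym irr _ _ euv; apply/eqP => duv.
have low x y : e x y -> dist x = dist y -> x == r.
  move=> exy dxy; apply/negPn/negP => /dist_parent[w ewx dw].
  rewrite sym in exy.
  have wy := lower_neighbour_unique ewx exy (ltnW dw) (eq_leq (esym dxy)).
  by rewrite wy dxy ltnn in dw.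
have /eqP ur := low _ _ euv duv.
have evu : e v u by rewrite sym.
have /eqP vr := low _ _ evu (esym duv).
by rewrite ur vr irr in euv.
Qed.

Definition parent v := odflt r [pick u | e u v && (dist u < dist v)].

Lemma parentP v : v != r -> e (parent v) v /\ dist (parent v) < dist v.
Proof.
move=> /dist_parent[u euv du]; rewrite /parent; case: pickP => [w /andP[]//|].
by move=> /(_ u); rewrite euv du.
Qed.

Lemma dist_root : dist r = 0.
Proof. by apply/eqP; rewrite -leqn0; exact: (@dist_le [::]). Qed.

Lemma edge_parent u v :
  e u v <-> (u != r /\ parent u = v) \/ (v != r /\ parent v = u).
Proof.
case: (tree_e) => _ sym _ _ _.
have half x y : e x y -> dist x < dist y -> y != r /\ parent y = x.
  move=> exy dxy; have yr : y != r.
    by apply/eqP => yr; rewrite yr dist_root in dxy.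
  split=> //; case: (parentP yr) => epy dp.
  exact: lower_neighbour_unique epy exy (ltnW dp) (ltnW dxy).
split=> [euv|]; last first.
  by case=> -[/parentP[h _] <-] //; rewrite sym.
have := adjacent_dist euv; rewrite neq_ltn => /orP[]; last rewrite sym in euv.
  by move=> /half-/(_ euv); right.
by move=> /half-/(_ euv); left.
Qed.

End TreeRooting.

Lemma tree_rooted n (e : rel 'I_n) : is_tree e ->
  exists par dep, rooted n par dep /\
    forall u v : 'I_n, e u v <-> par u = v \/ par v = u.
Proof.
move=> te; have n_gt0 : 0 < n by case: te; rewrite card_ord.
pose r := Ordinal n_gt0.
pose ord v := insubd r v.
pose par v := if v == 0 then n else val (parent r te (ord v)).
(* The shift by one leaves depth 0 to the virtual vertex [n]. *)
pose dep v := if v == n then 0 else (dist r te (ord v)).+1.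
have ordE (u : 'I_n) : ord u = u by exact: valKd.
have ordN v : 0 < v < n -> ord v != r.
  by case/andP=> v0 vn; rewrite -val_eqE val_insubd vn -lt0n.
have parlt v : 0 < v < n -> par v < n.
  by case/andP=> v0 vn; rewrite /par eqn0Ngt v0 ltn_ord.
have par0 : par 0 = n by [].
exists par, dep; split=> //.
  split=> v vn; last first.
  - case: (posnP v) => [->|v0]; first by rewrite par0 /dep eqxx; case: eqP; lia.
    have /ordN/(parentP te) [_] : 0 < v < n by rewrite v0.
    by rewrite /dep /par eqn0Ngt v0 /= ordE !ltn_eqF.
  - case: (posnP v) => [->|v0]; first by rewrite par0 !eqxx.
    by rewrite ltn_eqF ?parlt ?v0 // eqn0Ngt v0.
  - by case: (posnP v) => [->|v0]; rewrite ?par0 // ltnW // parlt // v0.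
have aux (u v : 'I_n) : (u != r /\ parent r te u = v) <-> par u = v.
  rewrite /par -val_eqE ordE /=; case: eqP => /= [u0|_].
    by split=> [[]//|nv]; have := ltn_ord v; rewrite -nv ltnn.
  by split=> [[_ ->]|/val_inj ->].
by move=> u v; rewrite -!aux; exact: edge_parent.
Qed.

(** * Edge lists as sums over child-parent pairs *)

Lemma set2_eq (T : finType) (a b u v : T) :
  [set a; b] = [set u; v] -> (a = u /\ b = v) \/ (a = v /\ b = u).
Proof.
move=> E; have : [/\ a \in [set u; v], b \in [set u; v], u \in [set a; b]
  & v \in [set a; b]] by split; rewrite ?E ?set21 ?set22 // -E ?set21 ?set22.
rewrite !in_set2 => -[/pred2P[->|->] /pred2P[->|->] /pred2P[e1|e1] /pred2P[e2|e2]];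
  by subst; auto.
Qed.

Definition edge_pairs n (es : seq ('I_n * 'I_n)) : seq (nat * nat) :=
  rcons [seq (val p.1, val p.2) | p <- es] (0, n).

(** Three choices of [F] are needed: one for the degrees, one for the neighbour sums, and the
    constant 1, which counts the pairs. *)
Lemma sum_edge_pairs n (e : rel 'I_n) es par dep (F : nat -> nat -> nat) :
  0 < n -> rooted n par dep ->
  (forall u v : 'I_n, e u v <-> par u = v \/ par v = u) ->
  is_edge_list e es -> (forall x y, F x y = F y x) ->
  \sum_(p <- edge_pairs es) F p.1 p.2 = \sum_(c <- iota 0 n) F c (par c).
Proof.
move=> n_gt0 rt eP [uniq_es esP] Fsym.
have par0 : par 0 = n by apply/eqP; rewrite (par_eq_top rt).
have parlt v : 0 < v < n -> par v < n.
  case/andP=> v0 vn; rewrite ltn_neqAle (par_le rt) // (par_eq_top rt) //.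
  by rewrite -lt0n v0.
pose r := Ordinal n_gt0.
pose P (c : 'I_n) : 'I_n := insubd r (par c).
have PE (c : 'I_n) : c != r -> P c = par c :> nat.
  move=> cr; rewrite val_insubd parlt // ltn_ord andbT lt0n.
  by apply: contra cr => /eqP c0; apply/eqP/val_inj.
(* By symmetry of [F] the choice of the ordered pair does not matter, so [F] becomes a function of
   unordered edges. *)
pose G A := if [pick p : 'I_n * 'I_n | A == [set p.1; p.2]] is Some p
            then F p.1 p.2 else 0.
have GE (u v : 'I_n) : G [set u; v] = F u v.
  rewrite /G; case: pickP => [[a b] /eqP /= /set2_eq[[-> ->]|[-> ->]] //|].
  by move=> /(_ (u, v)); rewrite eqxx.
pose nr := [seq c <- enum 'I_n | c != r].
have perm : perm_eq [seq [set p.1; p.2] | p <- es] [seq [set c; P c] | c <- nr].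
  apply: uniq_perm => //.
    (* Two distinct vertices with the same edge to their parents would be parents of each other,
       against the depths. *)
    rewrite map_inj_in_uniq ?(filter_uniq _ (enum_uniq _)) // => a b.
    rewrite !mem_filter => /andP[ar _] /andP[br _] /set2_eq[[]//|[aP Pb]].
    have da := dep_par rt (ltn_ord a); have db := dep_par rt (ltn_ord b).
    by rewrite -(PE _ ar) Pb in da; rewrite -(PE _ br) -aP ltnNge ltnW in db.
  move=> A; apply/idP/idP => [Ain|/mapP[c]].
    case/mapP: (Ain) => -[u v] _ /= AE; rewrite AE in Ain *.
    have half (x y : 'I_n) : par x = y ->
        [set x; y] \in [seq [set c; P c] | c <- nr].
      move=> xy; apply/mapP.
      have xr : x != r.
        by apply/eqP => xr; have := ltn_ord y; rewrite -xy xr par0 ltnn.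
      exists x; first by rewrite mem_filter xr mem_enum.
      by congr [set _; _]; apply: val_inj; rewrite /= PE.
    by case: (iffLR (eP u v) (iffRL (esP u v) Ain)) => /half //; rewrite setUC.
  rewrite mem_filter => /andP[cr _] ->; apply/esP/eP; left.
  by rewrite PE.
rewrite /edge_pairs -cats1 big_cat big_seq1 big_map /=.
transitivity (\sum_(A <- [seq [set p.1; p.2] | p <- es]) G A + F 0 n).
  by rewrite big_map; congr (_ + _); apply: eq_bigr => p _; rewrite GE.
rewrite (perm_big _ perm) big_map big_filter big_enum_cond /=.
have -> : iota 0 n = index_iota 0 n by rewrite /index_iota subn0.
rewrite big_mkord [RHS](bigD1 r) //= par0 addnC; congr (_ + _).
by apply: eq_bigr => c cr; rewrite GE PE.
Qed.

(** * Pruning leaves *)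

Definition open_sum n (P : seq nat) (f : nat -> nat) :=
  \sum_(c <- iota 0 n | c \notin P) f c.

Lemma open_sum_rcons n P f v : v < n -> v \notin P ->
  open_sum n P f = f v + open_sum n (rcons P v) f.
Proof.
move=> vn vP; rewrite /open_sum -big_filter.
rewrite (bigD1_seq v) ?mem_filter ?mem_iota ?vP ?filter_uniq ?iota_uniq //=.
by rewrite big_filter_cond; congr (_ + _); apply: eq_bigl => c;
  rewrite mem_rcons inE negb_or andbC.
Qed.

Lemma open_sum_eq0 n P f c :
  open_sum n P f = 0 -> c < n -> c \notin P -> f c = 0.
Proof. by move=> f0 cn cP; move: f0; rewrite (open_sum_rcons _ cn cP); lia. Qed.

(** The first [i] entries of [q] are pruned; all other vertices, [n] included, are open. Pruning
    changes the counters of the parent only, so for [v < n] the edge to the parent always stays in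
    [deg v] and [sm v]. A vertex is queued when nothing else remains, and from then on [sm] is its
    parent for good. [S_open] is the conserved total. In [bb_heavy], the value 0 stands for a vertex
    without pruned children. *)
Record prune_inv n (par : nat -> nat) (q : seq nat) (i : nat)
    (ord deg sm S bb h : nat -> nat) : Prop := PruneInv {
  q_uniq : uniq q;
  q_lt : forall v, v \in q -> v < n;
  q_size : i <= size q;
  q_ord : forall j, j < size q -> ord j = nth 0 q j;
  q_mem : forall v, v < n -> (v \in q) = (deg v == 1);
  q_child : forall c, c < n -> par c \in q -> index c q < index (par c) q;
  degE : forall v, v <= n ->
    deg v = (v < n) + open_sum n (take i q) (fun c => par c == v);
  smE : forall v, v <= n ->
    sm v = (v < n) * par v + open_sum n (take i q) (fun c => (par c == v) * c);
  SE : forall v, v <= n -> S v = 2 + \sum_(c <- take i q | par c == v) S c;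
  S_open : open_sum n.+1 (take i q) S = 2 * n.+1;
  S_le : forall v, v <= n -> S v <= 2 * n.+1;
  bb_ge : forall c, c \in take i q -> S c <= bb (par c);
  bb_heavy : forall v, v <= n -> bb v = 0 \/
    [/\ h v \in take i q, par (h v) = v & bb v = S (h v)] }.

Section Prune.
Variables (n : nat) (par dep : nat -> nat).
Hypothesis rt : rooted n par dep.
Variables (q : seq nat) (i : nat) (ord deg sm S bb h : nat -> nat).
Hypothesis inv : prune_inv n par q i ord deg sm S bb h.
Hypothesis i_lt : i < n.

(* A deepest vertex outside the processed prefix has no open child, hence is queued. *)
Lemma prune_queue_nonempty : i < size q.
Proof.
rewrite ltnNge; apply/negP => qi; pose P := take i q.
have PE : P = q by rewrite /P take_oversize.
have [v0 v0P] : exists v : 'I_n, val v \notin P.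
  apply/existsP; rewrite -negb_forall; apply/negP => /forallP allP.
  have : size (iota 0 n) <= size P.
    apply: uniq_leq_size; first exact: iota_uniq.
    by move=> v; rewrite mem_iota add0n => /= vn; exact: (allP (Ordinal vn)).
  by rewrite size_iota PE; lia.
case: (@arg_maxnP _ v0 (fun v : 'I_n => val v \notin P) (fun v => dep v) v0P).
move=> v vP vmax; have vn := ltn_ord v.
have dv := degE inv (ltnW vn); rewrite vn in dv.
move: (vP); rewrite {1}PE (q_mem inv) // dv; apply/negP/negPn.
rewrite -[1 in X in _ == X]addn0 eqn_add2l; apply/eqP.
rewrite /open_sum big_seq_cond big1 // => c; rewrite mem_iota add0n => /= /andP[cn cP].
apply/eqP; rewrite eqb0; apply/eqP => cv.
have := vmax (Ordinal cn) cP; rewrite /= leqNgt -cv.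
by rewrite (dep_par rt).
Qed.

Let v := ord i.
Let p := par v.

Lemma prune_head : [/\ v < n, v \in q, v \notin take i q & v = nth 0 q i].
Proof.
have iq := prune_queue_nonempty; have vE : v = nth 0 q i by rewrite /v (q_ord inv).
have vq : v \in q by rewrite vE mem_nth.
split=> //; first exact: (q_lt inv).
by rewrite in_take // vE index_uniq ?(q_uniq inv) // ltnn.
Qed.

Lemma prune_parent : sm v = p.
Proof.
case: prune_head => vn vq vP _; rewrite (smE inv) ?(ltnW vn) // vn mul1n.
rewrite /open_sum big_seq_cond big1 ?addn0 // => c.
rewrite mem_iota add0n /= => /andP[cn cP].
have := degE inv (ltnW vn); rewrite vn; move: vq; rewrite (q_mem inv) // => /eqP->.
by rewrite -{1}[1]addn0 => /addnI/esym/open_sum_eq0-/(_ _ cn cP) ->.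
Qed.

Lemma prune_parent_open : [/\ p <= n, p != v & p \notin q].
Proof.
case: prune_head => vn vq vP _; have pn := par_le rt vn; split=> //.
  by apply/eqP => pv; have := dep_par rt vn; rewrite -/p pv ltnn.
apply/negP => pq; have pn' := q_lt inv pq; move: pq.
rewrite (q_mem inv) // (degE inv pn) pn' (open_sum_rcons _ vn vP) /= -/p eqxx.
by lia.
Qed.

Let deg' := upd deg p (deg p - 1).
Let q' := if deg' p == 1 then rcons q p else q.

Lemma take_prune : take i.+1 q' = rcons (take i q) v.
Proof.
have iq := prune_queue_nonempty; case: prune_head => _ _ _ ->.
have <- : take i.+1 q = rcons (take i q) (nth 0 q i) by rewrite -take_nth.
by rewrite /q'; case: ifP => // _; rewrite -cats1 takel_cat.
Qed.

Lemma prune_step :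
  prune_inv n par q' i.+1 (upd ord (size q) p) deg' (upd sm p (sm p - v))
    (upd S p (S p + S v)) (if bb p < S v then upd bb p (S v) else bb)
    (if bb p < S v then upd h p v else h).
Proof.
have iq := prune_queue_nonempty; case: prune_head => vn vq vP vE.
case: prune_parent_open => pn pv pq; have take' := take_prune.
have vp : v != p by rewrite eq_sym.
have pP : p \notin take i q by apply: contra pq; exact: mem_take.
have degp : deg p = (p < n) + 1 + open_sum n (rcons (take i q) v) (fun c => par c == p).
  by rewrite (degE inv pn) (open_sum_rcons _ vn vP) /= -/p eqxx addnA.
have deg'p : deg' p = deg p - 1 by rewrite /deg' /upd eqxx.
have deg'E w : w <= n ->
    deg' w = (w < n) + open_sum n (rcons (take i q) v) (fun c => par c == w).
  move=> wn; rewrite /deg' /upd; case: eqP => [->|/eqP wp].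
    by rewrite degp; lia.
  by rewrite (degE inv wn) (open_sum_rcons _ vn vP) /= -/p eq_sym (negPf wp).
(* The only child of the virtual vertex is 0, so its degree falls to 0 and it is never queued. *)
have p_top : p = n -> deg' p != 1.
  move=> pE; rewrite deg'E // pE ltnn add0n /open_sum.
  have v0 : v = 0 by apply/eqP; rewrite -(par_eq_top rt) // -/p pE.
  rewrite big_seq_cond big1 // => c.
  rewrite mem_iota add0n /= mem_rcons inE negb_or v0 => /andP[cn /andP[c0 _]].
  by rewrite (par_eq_top rt) // (negPf c0).
have memq' w : (w \in q') = (w \in q) || (w == p) && (deg' p == 1).
  by rewrite /q'; case: ifP; rewrite ?andbF ?orbF // mem_rcons inE andbT orbC.
have S'P : forall c, c \in rcons (take i q) v -> upd S p (S p + S v) c = S c.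
  move=> c; rewrite mem_rcons inE /upd; case: (c =P p) => // -> /orP[|].
    by rewrite (negPf pv).
  by rewrite (negPf pP).
(* [v] and [p] are distinct open vertices, so both count in the conserved total. *)
have Sopen : S v + S p <= 2 * n.+1.
  rewrite -(S_open inv) (open_sum_rcons _ (ltnW vn : v < n.+1) vP) leq_add2l.
  rewrite (@open_sum_rcons _ _ _ p) ?leq_addr //.
  by rewrite mem_rcons inE negb_or pv.
(* Once the parent is a leaf, all its children are pruned; this places them before it in the
   queue. *)
have child_pP c : deg' p == 1 -> c < n -> par c = p -> c \in rcons (take i q) v.
  move=> /eqP d1 cn cp; apply/negPn/negP => cP.
  have pn' : p < n by rewrite ltn_neqAle pn andbT; apply/eqP => /p_top; rewrite d1.
  have := deg'E p pn; rewrite d1 pn' -{1}[1]addn0 => /addnI/esym.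
  by move=> /open_sum_eq0-/(_ _ cn cP); rewrite /= cp eqxx.
split; rewrite ?take'.
- rewrite /q'; case: ifP => _; last exact: (q_uniq inv).
  by rewrite rcons_uniq pq (q_uniq inv).
- move=> w; rewrite memq' => /orP[/(q_lt inv)//|/andP[/eqP -> d1]].
  by rewrite ltn_neqAle pn andbT; apply/eqP => /p_top; rewrite d1.
- by rewrite /q'; case: ifP => _; rewrite ?size_rcons //; lia.
- move=> j; rewrite /upd /q'; case: ifP => _.
    rewrite size_rcons nth_rcons ltnS leq_eqVlt; case: eqP => [->|_ /=].
      by rewrite ltnn.
    by move=> jq; rewrite jq (q_ord inv).
  by move=> jq; rewrite ltn_eqF // (q_ord inv).
- move=> w wn; rewrite memq' (q_mem inv) //.
  case: (w =P p) => [wp|/eqP wp] /=; last by rewrite orbF /deg' /upd (negPf wp).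
  by rewrite wp in wn *; rewrite -(q_mem inv) // (negPf pq).
- have old c : c < n -> par c \in q -> index c q < index (par c) q.
    exact: (q_child inv).
  rewrite /q'; case: ifP => // d1 c cn; rewrite mem_rcons inE => parc.
  have idx x : x \in q -> index x (rcons q p) = index x q.
    by move=> xq; rewrite -cats1 index_cat xq.
  case/orP: parc => [/eqP cp|cq].
    have cq : c \in q.
      have := child_pP c d1 cn cp.
      by rewrite mem_rcons inE => /predU1P[->//|/mem_take].
    by rewrite idx // cp -cats1 index_cat (negPf pq) /= eqxx addn0 index_mem.
  have lt := old c cn cq.
  have cq' : c \in q by rewrite -index_mem (ltn_trans lt) // index_mem.
  by rewrite !idx.
- exact: deg'E.
- move=> w wn; rewrite /upd; case: eqP => [->|/eqP wp].
    by rewrite (smE inv pn) (open_sum_rcons _ vn vP) /= -/p eqxx; lia.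
  by rewrite (smE inv wn) (open_sum_rcons _ vn vP) /= -/p eq_sym (negPf wp).
- move=> w wn; rewrite big_seq_cond (eq_bigr S); last by move=> c /andP[/S'P].
  rewrite -big_seq_cond -cats1 big_cat /= big_cons big_nil addn0 addnA -(SE inv wn).
  by rewrite /upd -/p eq_sym; case: eqP => [->|_]; rewrite ?addn0.
- have pPv : p \notin rcons (take i q) v by rewrite mem_rcons inE negb_or pv.
  have pn1 : p < n.+1 by [].
  have := S_open inv; rewrite (open_sum_rcons _ (ltnW vn : v < n.+1) vP).
  rewrite !(open_sum_rcons _ pn1 pPv) => <-.
  have -> : upd S p (S p + S v) p = S p + S v by rewrite /upd eqxx.
  have -> : open_sum n.+1 (rcons (rcons (take i q) v) p) (upd S p (S p + S v)) =
            open_sum n.+1 (rcons (rcons (take i q) v) p) S.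
    apply: eq_bigr => c; rewrite mem_rcons inE negb_or /upd.
    by case/andP=> /negPf ->.
  by rewrite addnA [S v + _]addnC.
- move=> w wn; rewrite /upd; case: eqP => _; [lia | exact: (S_le inv)].
- move=> c cPv; rewrite S'P //.
  move: cPv; rewrite mem_rcons inE => /predU1P[->|cP].
    by rewrite -/p; case: ltnP => // _; rewrite /upd eqxx.
  have := bb_ge inv cP; case: ifP => // lt; rewrite /upd.
  by case: eqP => // -> /leq_trans; apply; exact: ltnW.
- move=> w wn; case: ltnP => lt.
    rewrite /upd; case: (w =P p) => [->|_].
      by right; rewrite (negPf vp) mem_rcons mem_head.
    case: (bb_heavy inv wn) => [->|[hP hw bE]]; [by left | right; split=> //].
      by rewrite mem_rcons inE hP orbT.
    rewrite bE -[RHS]/(upd S p (S p + S v) (h w)) S'P //.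
    by rewrite mem_rcons inE hP orbT.
  case: (bb_heavy inv wn) => [->|[hP hw bE]]; [by left | right; split=> //].
    by rewrite mem_rcons inE hP orbT.
  by rewrite bE S'P // mem_rcons inE hP orbT.
Qed.

End Prune.

(** * Coordinates *)

Lemma prune_init n (par ord deg sm : nat -> nat) h :
  (forall v, v <= n -> deg v = (v < n) + open_sum n [::] (fun c => par c == v)) ->
  (forall v, v <= n ->
    sm v = (v < n) * par v + open_sum n [::] (fun c => (par c == v) * c)) ->
  let q := [seq v <- iota 0 n | deg v == 1] in
  (forall j, j < size q -> ord j = nth 0 q j) ->
  prune_inv n par q 0 ord deg sm (fun=> 2) (fun=> 0) h.
Proof.
move=> degE smE q ordE; have qE v : (v \in q) = (deg v == 1) && (v < n).
  by rewrite mem_filter mem_iota.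
split; rewrite ?take0 //.
- by rewrite filter_uniq ?iota_uniq.
- by move=> v; rewrite qE => /andP[].
- by move=> v vn; rewrite qE vn andbT.
- move=> c cn; rewrite qE => /andP[/eqP d1 pn]; have := degE _ (ltnW pn).
  rewrite d1 pn -{1}[1]addn0 => /addnI/esym/open_sum_eq0-/(_ _ cn isT).
  by rewrite /= eqxx.
- by move=> v vn; rewrite big_nil.
- by rewrite /open_sum big_const_seq count_predT size_iota iter_addn_0.
- by move=> v _; lia.
- by move=> v _; left.
Qed.

(** All that the geometry uses of the algorithm. A heavy child fills exactly the reserved end of its
    parent's interval. The bound [S v <= b (par v)], the maximality of the heavy child, makes the
    light depth logarithmic. The offset in [X (par v) + 2] puts light children strictly to the right
    of the left edge of their parent. *)
Record placed n (par X S b d : nat -> nat) (heavy : nat -> bool) : Prop := Placed {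
  pl_b : forall v, v <= n -> 1 <= b v < S v;
  pl_heavy : forall v, v < n -> heavy v ->
    [/\ X v = X (par v) + S (par v) - b (par v), S v = b (par v) & d v = d (par v)];
  pl_light : forall v, v < n -> ~~ heavy v ->
    [/\ X (par v) + 2 <= X v, X v + S v <= X (par v) + S (par v) - b (par v),
        S v <= b (par v) & d v = (d (par v)).+1];
  pl_sib : forall u v, u < n -> v < n -> u != v -> par u = par v ->
    X u + S u <= X v \/ X v + S v <= X u }.

Section Place.
Variables (n : nat) (par dep : nat -> nat).
Hypothesis rt : rooted n par dep.
Variables (q : seq nat) (ord deg sm S bb h : nat -> nat).
Hypothesis fin : prune_inv n par q n ord deg sm S bb h.

Lemma size_queue : size q = n.
Proof.
apply/eqP; rewrite eqn_leq (q_size fin) andbT -[n](size_iota 0).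
apply: uniq_leq_size; first exact: (q_uniq fin).
by move=> v /(q_lt fin); rewrite mem_iota.
Qed.

Lemma mem_queue v : (v \in q) = (v < n).
Proof.
have sub : {subset q <= iota 0 n} by move=> w /(q_lt fin); rewrite mem_iota.
have le : size (iota 0 n) <= size q by rewrite size_iota size_queue.
by have [_ ->] := uniq_min_size (q_uniq fin) sub le; rewrite mem_iota.
Qed.

Lemma take_queue : take n q = q.
Proof. by rewrite take_oversize ?size_queue. Qed.

Lemma S_ge2 v : v <= n -> 2 <= S v.
Proof. by move=> vn; rewrite (SE fin vn) leq_addr. Qed.

Lemma bb_child c : c < n -> S c <= bb (par c).
Proof. by move=> cn; apply: (bb_ge fin); rewrite take_queue mem_queue. Qed.

Lemma heavyP v : v <= n -> bb v = 0 \/ [/\ h v < n, par (h v) = v & bb v = S (h v)].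
Proof.
by move=> /(bb_heavy fin); rewrite take_queue mem_queue.
Qed.

(** Stated for a suffix of the queue, because during the assignment of coordinates the placed
    children are those in a suffix. The term [bb w] is the width of the heavy child, taken out of
    the sum in [SE]. *)
Lemma light_room w k : w <= n ->
  2 + \sum_(c <- drop k q | (par c == w) && (h w != c)) S c + bb w <= S w.
Proof.
move=> wn; rewrite (SE fin wn) take_queue -addnA leq_add2l.
rewrite [X in _ <= X](bigID (fun c => h w != c)) /=.
apply: leq_add; first by rewrite -{2}(cat_take_drop k q) big_cat leq_addl.
case: (heavyP wn) => [->//|[hn hw ->]].
rewrite (big_rem (h w)) ?mem_queue //= hw !eqxx /=; exact: leq_addr.
Qed.

(** The last [j] entries of the queue are placed. [N] is an exact sum rather than a bound: with
    [light_room] this shows that the next light child still fits before the heavy one. [d_le] and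
    [X_le] serve the word bound. *)
Record place_inv (j : nat) (X N d : nat -> nat) : Prop := PlaceInv {
  X_top : X n = 0;
  d_top : d n = 0;
  d_le : forall w, w <= n -> d w <= j;
  X_le : forall w, w <= n -> X w + S w <= 2 * n.+1;
  N_top : N n = X n + 2 + \sum_(c <- drop (n - j) q | (par c == n) && (h n != c)) S c;
  NE : forall w, w \in drop (n - j) q ->
    N w = X w + 2 + \sum_(c <- drop (n - j) q | (par c == w) && (h w != c)) S c;
  in_heavy : forall c, c \in drop (n - j) q -> h (par c) == c ->
    X c = X (par c) + S (par c) - bb (par c) /\ d c = d (par c);
  in_light : forall c, c \in drop (n - j) q -> h (par c) != c ->
    [/\ X (par c) + 2 <= X c, X c + S c <= N (par c) & d c = (d (par c)).+1];
  in_sib : forall u v, u \in drop (n - j) q -> v \in drop (n - j) q -> u != v ->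
    par u = par v -> h (par u) != u -> h (par u) != v ->
    X u + S u <= X v \/ X v + S v <= X u }.

Lemma place_init : place_inv 0 (fun=> 0) (upd (fun=> 0) n 2) (fun=> 0).
Proof.
have dropE : drop (n - 0) q = [::] by rewrite subn0 drop_oversize ?size_queue.
split; rewrite ?dropE ?big_nil //; last by rewrite /upd eqxx.
by move=> w /(S_le fin).
Qed.

Section Step.
Variables (j : nat) (X N d : nat -> nat).
Hypothesis inv : place_inv j X N d.
Hypothesis j_lt : j < n.

Let v := nth 0 q (n - j - 1).
Let p := par v.

Lemma place_head : [/\ v < n, v \notin drop (n - j) q,
  drop (n - j.+1) q = v :: drop (n - j) q & p = n \/ p \in drop (n - j) q].
Proof.
have ltq : n - j - 1 < size q by rewrite size_queue; lia.
have vq : v \in q by rewrite mem_nth.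
have vn : v < n by rewrite -mem_queue.
have dropE : drop (n - j.+1) q = v :: drop (n - j) q.
  have -> : n - j.+1 = n - j - 1 by lia.
  by rewrite (drop_nth 0) // (_ : (n - j - 1).+1 = n - j) //; lia.
have uq : uniq (drop (n - j.+1) q) by rewrite drop_uniq // (q_uniq fin).
split=> //; first by move: uq; rewrite dropE => /andP[].
case: (ltngtP p n) (par_le rt vn : p <= n) => // [pn _|-> _]; last by left.
right; have pq : p \in q by rewrite mem_queue.
have := q_child fin vn pq; rewrite -/p {1}/v index_uniq ?(q_uniq fin) // => lt.
rewrite -(nth_index 0 pq) -(subnKC (_ : n - j <= index p q)); last by lia.
rewrite -nth_drop mem_nth // size_drop size_queue.
by have := index_mem p q; rewrite pq size_queue; lia.
Qed.

Lemma N_parent :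
  N p = X p + 2 + \sum_(c <- drop (n - j) q | (par c == p) && (h p != c)) S c.
Proof.
by case: place_head => _ _ _ [->|]; [exact: (N_top inv) | exact: (NE inv)].
Qed.

Let x := if h p == v then X p + S p - bb p else N p.
Let X' := upd X v x.
Let N' := upd (if h p == v then N else upd N p (N p + S v)) v (x + 2).
Let d' := upd d v (if h p == v then d p else (d p).+1).

Lemma light_slot : h p != v -> N p + S v + bb p <= X p + S p.
Proof.
case: place_head => vn vD dropE _ hv; have pn : p <= n := par_le rt vn.
have := light_room (n - j.+1) pn; rewrite dropE big_cons -/p eqxx hv /=.
by rewrite N_parent; lia.
Qed.

Lemma place_step : place_inv j.+1 X' N' d'.
Proof.
case: place_head => vn vD dropE pD; have pn : p <= n := par_le rt vn.
have pv : p != v by apply/eqP => pv; have := dep_par rt vn; rewrite -/p pv ltnn.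
have vp : (v == p) = false by rewrite eq_sym (negPf pv).
have nv : (n == v) = false by apply/eqP => nv; rewrite -nv ltnn in vn.
have Sv := S_ge2 (ltnW vn); have SbP : S v <= bb p := bb_child vn.
have Np := N_parent.
have roomp := light_room n pn.
have xlb : X p + 2 <= x.
  by rewrite /x; case: ifP => _; lia.
have xub : x + S v <= X p + S p.
  rewrite /x; case: ifP => [/eqP hv|/negbT/light_slot]; last lia.
  case: (heavyP pn) => [|[_ _]]; rewrite ?hv => E; lia.
(* Children precede their parents in the queue, so no child of [v] is placed yet and the free
   abscissa of [v] starts at [x + 2]. *)
have parD c : c \in drop (n - j) q -> par c != v.
  move=> cD; apply/eqP => cv; have cq := mem_drop cD.
  have cn : c < n by rewrite -mem_queue.
  have := q_child fin cn; rewrite cv mem_queue => /(_ vn).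
  rewrite /v index_uniq ?(q_uniq fin) ?size_queue //; last by lia.
  move=> lt; have : c \in take (n - j) q by rewrite in_take //; lia.
  have := q_uniq fin; rewrite -{1}(cat_take_drop (n - j) q) cat_uniq.
  by case/and3P=> _ /hasPn/(_ _ cD) /negP.
have XD c : c != v -> X' c = X c by move=> cv; rewrite /X' /upd (negPf cv).
have dD c : c != v -> d' c = d c by move=> cv; rewrite /d' /upd (negPf cv).
have X'v : X' v = x by rewrite /X' /upd eqxx.
have d'v : d' v = if h p == v then d p else (d p).+1 by rewrite /d' /upd eqxx.
have ND c : c != v -> N' c = if (h p != v) && (c == p) then N p + S v else N c.
  by move=> cv; rewrite /N' /upd (negPf cv); case: (h p == v).
have Dv c : c \in drop (n - j) q -> c != v.
  by move=> cD; apply: contra vD => /eqP <-.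
have NDle c : c != v -> N c <= N' c.
  by move=> cv; rewrite ND //; case: ifP => // /andP[_ /eqP->]; lia.
have NDE w : w != v -> N w =
      X w + 2 + \sum_(c <- drop (n - j) q | (par c == w) && (h w != c)) S c ->
    N' w = X' w + 2 +
      \sum_(c <- v :: drop (n - j) q | (par c == w) && (h w != c)) S c.
  move=> wv Nw; rewrite ND // XD // big_cons -/p.
  case: (w =P p) Nw => [->|/eqP wp] Nw; last first.
    by rewrite andbF [p == w]eq_sym (negPf wp).
  by rewrite eqxx andbT /= Nw; case: (h p != v) => //=; lia.
split; rewrite ?dropE.
- by rewrite XD ?nv // (X_top inv).
- by rewrite dD ?nv // (d_top inv).
- move=> w wn; case: (w =P v) => [->|/eqP wv].
    by rewrite d'v; have := d_le inv pn; case: ifP => _; lia.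
  by rewrite dD //; have := d_le inv wn; lia.
- move=> w wn; case: (w =P v) => [->|/eqP wv].
    by rewrite X'v; have := X_le inv pn; lia.
  by rewrite XD //; exact: (X_le inv).
- by apply: NDE; [rewrite nv | exact: (N_top inv)].
- move=> w; rewrite inE => /predU1P[->|wD]; last first.
    by apply: NDE; [exact: Dv | exact: (NE inv)].
  rewrite /N' X'v /upd eqxx big_seq_cond big_pred0 ?addn0 // => c.
  apply/negP => /and3P[]; rewrite inE => /predU1P[->|/parD/negPf->//].
  by rewrite -/p (negPf pv).
- move=> c; rewrite inE => /predU1P[->|cD] hc.
    by rewrite -/p in hc *; rewrite X'v d'v XD // dD // /x hc.
  by rewrite !XD ?dD ?parD ?Dv //; exact: (in_heavy inv).
- move=> c; rewrite inE => /predU1P[->|cD] hc.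
    rewrite -/p in hc *; rewrite X'v d'v XD // dD // ND // hc eqxx /=.
    by rewrite (negPf hc); split=> //; rewrite /x (negPf hc).
  rewrite !XD ?dD ?parD ?Dv //; case: (in_light inv cD hc) => h1 h2 h3; split=> //.
  by apply: leq_trans h2 _; apply: NDle; exact: parD.
- have new c : c \in drop (n - j) q -> h p != v -> par c = p -> h p != c ->
      X c + S c <= x.
    move=> cD hv cp hc; have := in_light inv cD; rewrite cp => /(_ hc)[_ le _].
    by rewrite /x (negPf hv).
  move=> u w; rewrite !inE => /predU1P[->|uD] /predU1P[->|wD] uw parE hu hw.
  + by rewrite eqxx in uw.
  + rewrite -/p in parE hu hw; right; rewrite X'v XD ?Dv //.
    by apply: new => //; rewrite parE.
  + rewrite parE -/p in hu hw; left; rewrite X'v XD ?Dv //.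
    by apply: new.
  + by rewrite !XD ?Dv //; exact: (in_sib inv).
Qed.

End Step.

Lemma place_final X N d : place_inv n X N d ->
  placed n par X S (fun v => maxn 1 (bb v)) d (fun v => h (par v) == v).
Proof.
move=> inv; have dropE : drop (n - n) q = q by rewrite subnn drop0.
(* A vertex with a child has [bb] at least 2; the maximum with 1 matters only at leaves. *)
have bbc c : c < n -> maxn 1 (bb (par c)) = bb (par c).
  by move=> cn; have := bb_child cn; have := S_ge2 (ltnW cn); lia.
have room c : c < n -> h (par c) != c -> X c + S c <= X (par c) + S (par c) - bb (par c).
  move=> cn hc; have pn := par_le rt cn.
  have := in_light inv; rewrite dropE => /(_ c); rewrite mem_queue => /(_ cn hc)[_ le _].
  have NEp : N (par c) = X (par c) + 2 +
      \sum_(c0 <- drop 0 q | (par c0 == par c) && (h (par c) != c0)) S c0.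
    rewrite drop0; case: (ltngtP (par c) n) pn => // [lt|->] _.
      by have := NE inv; rewrite dropE; apply; rewrite mem_queue.
    by have := N_top inv; rewrite dropE.
  by have := light_room 0 pn; lia.
split=> [v vn|v vn hv|v vn hv|u v un vn uv uvp].
- have := light_room 0 vn; have := S_ge2 vn; lia.
- rewrite bbc //; have := in_heavy inv; rewrite dropE => /(_ v).
  rewrite mem_queue => /(_ vn hv)[-> ->]; split=> //.
  case: (heavyP (par_le rt vn)) => [b0|[_ _ ->]]; last by rewrite (eqP hv).
  by have := bb_child vn; have := S_ge2 (ltnW vn); lia.
- rewrite bbc //; have := in_light inv; rewrite dropE => /(_ v).
  rewrite mem_queue => /(_ vn hv)[h1 _ ->]; split=> //; first exact: room.
  exact: bb_child.
- have hX c : c < n -> h (par c) == c -> X c = X (par c) + S (par c) - bb (par c).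
    move=> cn hc; have := in_heavy inv; rewrite dropE => /(_ c).
    by rewrite mem_queue => /(_ cn hc)[].
  case: (boolP (h (par u) == u)) => hu.
    have hv : h (par v) != v by rewrite -uvp (eqP hu).
    by right; rewrite (hX u) // uvp; exact: room.
  case: (boolP (h (par v) == v)) => hv.
    by left; rewrite (hX v) // -uvp; exact: room.
  have := in_sib inv; rewrite dropE; apply; rewrite ?mem_queue //.
  by rewrite uvp.
Qed.

End Place.

(** * Geometry *)

Inductive ancestor (n : nat) (par : nat -> nat) (u : nat) : nat -> Prop :=
| AncRefl : ancestor n par u u
| AncStep v : v < n -> ancestor n par u (par v) -> ancestor n par u v.

Section Ancestors.
Variables (n : nat) (par dep : nat -> nat).
Hypothesis rt : rooted n par dep.

Lemma dep_ind (Q : nat -> Prop) :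
  Q n -> (forall v, v < n -> Q (par v) -> Q v) -> forall v, v <= n -> Q v.
Proof.
move=> Qn Qs v; have [k] := ubnP (dep v); elim: k v => // k IH v.
rewrite ltnS => dk vn; case: (ltngtP v n) vn => // [vn _|-> //].
apply: Qs => //; apply: IH; last exact: (par_le rt).
exact: leq_trans (dep_par rt vn) dk.
Qed.

Lemma ancestor_top v : v <= n -> ancestor n par n v.
Proof. by move: v; apply: dep_ind => [|v vn]; [left | right]. Qed.

Lemma ancestor_child u v : ancestor n par u v ->
  v = u \/ exists c, [/\ c < n, par c = u & ancestor n par c v].
Proof.
elim=> [|{}v vn _ [pu|[c [cn cu cv]]]]; first by left.
  by right; exists v; split=> //; left.
by right; exists c; split=> //; right.
Qed.

Section Placed.
Variables (X S b d : nat -> nat) (heavy : nat -> bool).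
Hypothesis pl : placed n par X S b d heavy.

(** The last clause separates the rows: a proper descendant of equal light depth is reached by heavy
    steps alone, since a light step increases [d]. *)
Lemma ancestor_placed u v : u <= n -> ancestor n par u v ->
  [/\ X u <= X v, X v + S v <= X u + S u, d u <= d v &
      v = u \/ X u < X v /\ (d v = d u -> heavy v)].
Proof.
move=> un; elim=> [|{}v vn _ [IH1 IH2 IH3 IH4]]; first by split=> //; left.
have bp := pl_b pl (par_le rt vn).
case: (boolP (heavy v)) => hv.
  have [h1 h2 h3] := pl_heavy pl vn hv.
  by split; rewrite ?h3; [lia|lia|lia|right; split=> //; lia].
have [h1 h2 h3 h4] := pl_light pl vn hv.
by split; rewrite ?h4; [lia|lia|lia|right; split=> //; lia].
Qed.

(** The intervals form a laminar family. In the induction from the root down to [v], the case that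
    needs an argument is [par v] above [u]: then [u] is [par v] or lies below one of its children,
    and siblings have disjoint intervals. *)
Lemma ancestor_or_disjoint u v : u <= n -> v <= n ->
  [\/ ancestor n par u v, ancestor n par v u, X u + S u <= X v | X v + S v <= X u].
Proof.
move=> un; move: v; apply: dep_ind => [|v vn IH].
  by constructor 2; exact: ancestor_top.
have pn := par_le rt vn.
have [x1 x2 _ _] : [/\ X (par v) <= X v, X v + S v <= X (par v) + S (par v),
    d (par v) <= d v & v = par v \/ X (par v) < X v /\ (d v = d (par v) -> heavy v)].
  by apply: ancestor_placed => //; right=> //; left.
case: IH => [h|h|h|h].
- by constructor 1; right.
- case: (ancestor_child h) => [->|[c [cn cp cu]]].
    by constructor 1; right => //; left.
  case: (c =P v) => [<-|/eqP cv]; first by constructor 2.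
  have [y1 y2 _ _] := ancestor_placed (ltnW cn) cu.
  by case: (pl_sib pl cn vn cv cp) => z; [constructor 3|constructor 4]; lia.
- by constructor 3; lia.
- by constructor 4; lia.
Qed.

(** The second axis points down, so [top_of] is the smaller ordinate. Each light depth has a row of
    height 2, of which heavy vertices fill the lower half. *)
Definition right_of v := X v + S v - b v.
Definition top_of v := 2 * d v + heavy v.
Definition bottom_of v := 2 * d v + 2.

(** Strict, so that not even a point is shared: contact is refuted by one common point, without any
    study of segments. *)
Definition apart u v := [\/ right_of u < X v, right_of v < X u,
  bottom_of u < top_of v | bottom_of v < top_of u].

Definition touching p v :=
  (right_of p = X v /\ top_of p <= top_of v /\ bottom_of v <= bottom_of p) \/
  (bottom_of p = top_of v /\ X p <= X v /\ right_of v <= right_of p).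

Lemma child_touching v : v < n -> touching (par v) v.
Proof.
move=> vn; have pn := par_le rt vn; rewrite /touching /right_of /top_of /bottom_of.
have bp := pl_b pl pn; have bv := pl_b pl (ltnW vn).
case: (boolP (heavy v)) => hv.
  have [h1 h2 h3] := pl_heavy pl vn hv; left.
  by case: (heavy _); lia.
by have [h1 h2 h3 h4] := pl_light pl vn hv; right; lia.
Qed.

(** Let [c] be the child of [u] above [v]. If [c] is heavy, its left edge lies on the right edge of
    [u], and [v] starts further right. If [c] is light, the row of [c] begins where that of [u]
    ends, and [v] is in a deeper row, or heavy and thus one unit lower. *)
Lemma descendant_apart u v : u <= n -> v < n -> u != v -> par v != u ->
  ancestor n par u v -> apart u v.
Proof.
move=> un vn uv pvu /ancestor_child[vu|[c [cn cu cv]]].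
  by rewrite vu eqxx in uv.
have [x1 x2 x3 x4] := ancestor_placed (ltnW cn) cv.
have {x4} [x4 x5] : X c < X v /\ (d v = d c -> heavy v).
  by case: x4 => // vc; rewrite vc cu eqxx in pvu.
rewrite /apart /right_of /top_of /bottom_of; have bu := pl_b pl un.
case: (boolP (heavy c)) => hc.
  have [h1 h2 h3] := pl_heavy pl cn hc; rewrite cu in h1.
  by constructor 1; lia.
have [h1 h2 h3 h4] := pl_light pl cn hc; rewrite cu in h4; constructor 3.
by case: (d v =P d c) => [/[dup] E /x5 ->|]; lia.
Qed.

Lemma nonadjacent_apart u v : u < n -> v < n -> u != v ->
  par u != v -> par v != u -> apart u v.
Proof.
move=> un vn uv puv pvu; have bu := pl_b pl (ltnW un); have bv := pl_b pl (ltnW vn).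
case: (ancestor_or_disjoint (ltnW un) (ltnW vn)) => h.
- exact: descendant_apart (ltnW un) _ _ _ _.
- rewrite eq_sym in uv; have := descendant_apart (ltnW vn) un uv puv h.
  by case=> k; [constructor 2|constructor 1|constructor 4|constructor 3].
- by constructor 1; rewrite /right_of; lia.
- by constructor 2; rewrite /right_of; lia.
Qed.

(* A light child occupies at most half the width of its parent. *)
Lemma width_bound v : v <= n -> S v * 2 ^ d v <= S n * 2 ^ d n.
Proof.
move: v; apply: dep_ind => // v vn; apply: leq_trans.
have bp := pl_b pl (par_le rt vn).
case: (boolP (heavy v)) => hv.
  by have [h1 h2 ->] := pl_heavy pl vn hv; rewrite leq_mul2r; lia.
have [h1 h2 h3 ->] := pl_light pl vn hv.
by rewrite expnS mulnA leq_mul2r; lia.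
Qed.

Lemma in_top_interval v : v <= n -> X v + S v <= X n + S n.
Proof. by move=> /ancestor_top/(ancestor_placed (leqnn n))[]. Qed.

End Placed.
End Ancestors.

(** * Contact and bounding boxes in the plane *)

Section Contact.
Local Open Scope ring_scope.
Variable R : realType.
Implicit Types r s : rect R.

Lemma contact_sym r s : contact r s -> contact s r.
Proof.
by move=> [p [q [pq H]]]; exists p, q; split=> // z /H [].
Qed.

Lemma contact_common r s : contact r s -> exists z, in_rect r z /\ in_rect s z.
Proof.
move=> [p [q [_ H]]]; exists p; have [|] := H p.
  by exists 0; rewrite ?lexx ?ler01 // subr0 !mul1r !mul0r !addr0; case: p {H}.
by case/andP=> -> _ /andP[-> _].
Qed.

Lemma contact_side r s : rect_valid s -> xmax r = xmin s -> ymin r <= ymin s ->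
  ymax s <= ymax r -> rect_valid r -> contact r s.
Proof.
case: r s => [a b c d] [a' b' c' d'] /andP[/= s1 s2] rs h1 h2 /andP[/= r1 r2].
exists (a', b'), (a', d'); split; first by case=> bd; rewrite bd ltxx in s2.
move=> z [t /andP[t0 t1] ->]; rewrite /in_boundary /in_rect /in_interior /=.
have -> : (1 - t) * a' + t * a' = a' by lra.
rewrite /= in rs h1 h2; subst c.
have y1 : b' <= (1 - t) * b' + t * d' by nra.
have y2 : (1 - t) * b' + t * d' <= d' by nra.
by rewrite y1 y2 (le_trans h1 y1) (le_trans y2 h2) !ltxx !lexx (ltW s1) (ltW r1) andbF.
Qed.

Lemma contact_below r s : rect_valid s -> ymax r = ymin s -> xmin r <= xmin s ->
  xmax s <= xmax r -> rect_valid r -> contact r s.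
Proof.
case: r s => [a b c d] [a' b' c' d'] /andP[/= s1 s2] rs h1 h2 /andP[/= r1 r2].
exists (a', b'), (c', b'); split; first by case=> bd; rewrite bd ltxx in s1.
move=> z [t /andP[t0 t1] ->]; rewrite /in_boundary /in_rect /in_interior /=.
have -> : (1 - t) * b' + t * b' = b' by lra.
rewrite /= in rs h1 h2; subst d.
have y1 : a' <= (1 - t) * a' + t * c' by nra.
have y2 : (1 - t) * a' + t * c' <= c' by nra.
by rewrite y1 y2 (le_trans h1 y1) (le_trans y2 h2) !ltxx !lexx (ltW s2) (ltW r2) !andbF.
Qed.

(** Each side of the box is attained by some rectangle, so every enclosing box contains it. *)
Lemma bounding_box_exists (T : finType) (L : T -> rect R) (w h : R) (x0 : T) :
  (forall v, rect_valid (L v)) ->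
  (forall v, [/\ 0 <= xmin (L v), 0 <= ymin (L v), xmax (L v) <= w & ymax (L v) <= h]) ->
  layout_area_le L (w * h).
Proof.
move=> valid bnd.
case: (arg_minP (fun v => xmin (L v)) (erefl : predT x0)) => i1 _ m1.
case: (arg_minP (fun v => ymin (L v)) (erefl : predT x0)) => i2 _ m2.
case: (arg_maxP (fun v => xmax (L v)) (erefl : predT x0)) => i3 _ m3.
case: (arg_maxP (fun v => ymax (L v)) (erefl : predT x0)) => i4 _ m4.
have corner v : in_rect (L v) (xmin (L v), ymin (L v)) /\
                in_rect (L v) (xmax (L v), ymax (L v)).
  by case/andP: (valid v) => vx vy; rewrite /in_rect /= !lexx !ltW.
exists (Rect (xmin (L i1)) (ymin (L i2)) (xmax (L i3)) (ymax (L i4))).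
  split.
    case/andP: (valid x0) => vx vy; rewrite /rect_valid /=.
    rewrite (le_lt_trans (m1 x0 isT) (lt_le_trans vx (m3 x0 isT))).
    by rewrite (le_lt_trans (m2 x0 isT) (lt_le_trans vy (m4 x0 isT))).
  split=> [v z|b' enc z].
    rewrite /in_rect /= => /andP[/andP[z1 z2] /andP[z3 z4]].
    rewrite (le_trans (m1 v isT) z1) (le_trans z2 (m3 v isT)).
    by rewrite (le_trans (m2 v isT) z3) (le_trans z4 (m4 v isT)).
  have [/enc e1 _] := corner i1; have [/enc e2 _] := corner i2.
  have [_ /enc e3] := corner i3; have [_ /enc e4] := corner i4.
  move: e1 e2 e3 e4; rewrite /in_rect /=.
  case/andP=> /andP[a1 _] _ /andP[_ /andP[a2 _]] /andP[/andP[_ a3] _].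
  case/andP=> _ /andP[_ a4] /andP[/andP[z1 z2] /andP[z3 z4]].
  by rewrite (le_trans a1 z1) (le_trans z2 a3) (le_trans a2 z3) (le_trans z4 a4).
have [p1 _ _ _] := bnd i1; have [_ p2 _ _] := bnd i2.
have [q1 _ p3 _] := bnd i3; have [_ q2 _ p4] := bnd i4.
case/andP: (valid i3) => v3 _; case/andP: (valid i4) => _ v4.
rewrite /rect_area /= ler_pM ?subr_ge0 //; try lra.
- exact: le_trans (m1 i3 isT) (ltW v3).
- exact: le_trans (m2 i4 isT) (ltW v4).
Qed.

End Contact.

Section PlacedLayout.
Local Open Scope ring_scope.
Variables (R : realType) (n : nat) (par dep : nat -> nat) (e : rel 'I_n).
Hypothesis rt : rooted n par dep.
Hypothesis eP : forall u v : 'I_n, e u v <-> par u = v \/ par v = u.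
Variables (X S b d : nat -> nat) (heavy : nat -> bool).
Hypothesis pl : placed n par X S b d heavy.

Definition placed_rect (v : 'I_n) : rect R :=
  Rect (X v)%:R (top_of d heavy v)%:R (right_of X S b v)%:R (bottom_of d v)%:R.

Lemma placed_rect_valid v : rect_valid (placed_rect v).
Proof.
rewrite /rect_valid /= !ltr_nat /right_of /top_of /bottom_of.
have := pl_b pl (ltnW (ltn_ord v)); case: (heavy v); lia.
Qed.

Lemma apart_disjoint (u v : 'I_n) z : apart X S b d heavy u v ->
  in_rect (placed_rect u) z -> in_rect (placed_rect v) z -> False.
Proof.
move=> ap /andP[/andP[/= u1 u2] /andP[u3 u4]] /andP[/andP[/= v1 v2] /andP[v3 v4]].
by case: ap; rewrite -(@ltr_nat R); lra.
Qed.

Lemma touching_contact (p v : 'I_n) : touching X S b d heavy p v ->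
  contact (placed_rect p) (placed_rect v).
Proof.
case=> -[h1 [h2 h3]].
  by apply: contact_side; rewrite ?placed_rect_valid //= ?h1 // ler_nat.
by apply: contact_below; rewrite ?placed_rect_valid //= ?h1 // ler_nat.
Qed.

Lemma touching_interior (p v : 'I_n) z : touching X S b d heavy p v ->
  ~ (in_interior (placed_rect p) z /\ in_interior (placed_rect v) z).
Proof.
move=> tc [/andP[/andP[/= u1 u2] /andP[u3 u4]] /andP[/andP[/= v1 v2] /andP[v3 v4]]].
case: tc => -[h1 _]; move: u2 v1 u4 v3; rewrite h1; lra.
Qed.

Lemma in_interior_rect (r : rect R) z : in_interior r z -> in_rect r z.
Proof. by case/andP=> /andP[a1 a2] /andP[a3 a4]; rewrite /in_rect !ltW. Qed.

Lemma placed_rectangular_layout : rectangular_layout e placed_rect.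
Proof.
split=> [v|u v uv z|u v uv]; first exact: placed_rect_valid.
  case: (par u =P v) => [puv|/eqP puv].
    move=> [zu zv]; apply: (@touching_interior v u z) => //.
    by rewrite -puv; apply: (child_touching rt pl).
  case: (par v =P u) => [pvu|/eqP pvu].
    by apply: touching_interior; rewrite -pvu; apply: (child_touching rt pl).
  move=> [/in_interior_rect zu /in_interior_rect zv].
  by apply: apart_disjoint zu zv; apply: (nonadjacent_apart rt pl) => //; apply/eqP => /val_inj.
split=> [/contact_common[z [zu zv]]|/eP[puv|pvu]].
- apply/eP; case: (par u =P v) => [|/eqP puv]; first by left.
  case: (par v =P u) => [|/eqP pvu]; first by right.
  case: (@apart_disjoint u v z) => //.
  by apply: (nonadjacent_apart rt pl) => //; apply/eqP => /val_inj.
- by apply/contact_sym/touching_contact; rewrite -puv; apply: (child_touching rt pl).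
- by apply: touching_contact; rewrite -pvu; apply: (child_touching rt pl).
Qed.

Lemma placed_on_integer_grid : on_integer_grid placed_rect.
Proof. by move=> v; split; rewrite natr_int. Qed.

(** As [S v] is at least 2, [width_bound] gives [2 ^ d v <= n.+1], so [d v] is at most
    [(trunc_log 2 n).+1]. For [1 < n] the width [2 * n.+1] is at most [3 * n] and the height
    [2 * (trunc_log 2 n).+2] at most [6 * trunc_log 2 n], whence 18. *)
Lemma placed_area (C : nat) : X n = 0 -> (S n <= 2 * n.+1)%N -> d n = 0%N ->
  (18 <= C)%N -> (1 < n)%N ->
  layout_area_le placed_rect (C * n * trunc_log 2 n)%:R.
Proof.
move=> Xn Sn dn C18 n1.
have dle (v : 'I_n) : (d v <= (trunc_log 2 n).+1)%N.
  have := width_bound rt pl (ltnW (ltn_ord v)); rewrite dn muln1 => wb.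
  have bv := pl_b pl (ltnW (ltn_ord v)).
  have : (2 ^ d v < 2 ^ (trunc_log 2 n).+2)%N.
    rewrite expnS; have := trunc_log_ltn n (isT : 1 < 2)%N; nia.
  by rewrite ltn_exp2l.
have log_gt0 : (0 < trunc_log 2 n)%N by rewrite trunc_log_gt0.
have x0 : 'I_n := Ordinal (ltnW n1).
have bnd (v : 'I_n) : [/\ 0 <= xmin (placed_rect v), 0 <= ymin (placed_rect v),
    xmax (placed_rect v) <= (2 * n.+1)%:R &
    ymax (placed_rect v) <= (2 * (trunc_log 2 n).+2)%:R].
  rewrite /= !ler0n !ler_nat /right_of /bottom_of; split=> //.
    have := in_top_interval rt pl (ltnW (ltn_ord v)); lia.
  by have := dle v; lia.
have [b0 [bv sb] area] := bounding_box_exists x0 placed_rect_valid bnd.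
exists b0 => //; apply: le_trans area _; rewrite -natrM ler_nat.
apply: (@leq_trans (18 * n * trunc_log 2 n)); last first.
  by rewrite !leq_mul2r C18 !orbT.
nia.
Qed.

End PlacedLayout.

(** * Loop-free programs *)

Fixpoint ev (s : state) (a : expr) : nat :=
  match a with
  | EConst k => k
  | EReg r => reg s r
  | ELoad a1 => mem s (ev s a1)
  | EAdd a1 a2 => ev s a1 + ev s a2
  | ESub a1 a2 => ev s a1 - ev s a2
  end.

(** Growth measured in the exponent of a base [N >= 2]: one factor [N] absorbs the doubling in an
    addition, and a constant [c] costs [c] because [c < N ^ c]. *)
Fixpoint eweight (a : expr) : nat :=
  match a with
  | EConst k => k
  | EReg _ => 0
  | ELoad a1 => eweight a1
  | EAdd a1 a2 | ESub a1 a2 => (eweight a1 + eweight a2).+1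
  end.

Fixpoint loop_free (c : cmd) : bool :=
  match c with
  | CSeq c1 c2 | CIfLt _ _ c1 c2 => loop_free c1 && loop_free c2
  | CWhileLt _ _ _ => false
  | _ => true
  end.

(* Junk on [CWhileLt]; only meaningful on [loop_free] programs. *)
Fixpoint sem (c : cmd) (s : state) : state :=
  match c with
  | CSkip | CWhileLt _ _ _ => s
  | CSet r a => State (upd (reg s) r (ev s a)) (mem s)
  | CStore a1 a2 => State (reg s) (upd (mem s) (ev s a1) (ev s a2))
  | CSeq c1 c2 => sem c2 (sem c1 s)
  | CIfLt a1 a2 c1 c2 => if ev s a1 < ev s a2 then sem c1 s else sem c2 s
  end.

Fixpoint cweight (c : cmd) : nat :=
  match c with
  | CSkip => 0
  | CSet _ a => eweight a
  | CStore a1 a2 => eweight a1 + eweight a2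
  | CSeq c1 c2 => cweight c1 + cweight c2
  | CIfLt a1 a2 c1 c2 => eweight a1 + eweight a2 + (cweight c1 + cweight c2)
  | CWhileLt a1 a2 c => eweight a1 + eweight a2 + cweight c
  end.

(** Both branches of a conditional are charged, so the bound does not depend on the state. *)
Fixpoint ccost (c : cmd) : nat :=
  match c with
  | CSkip => 1
  | CSet _ a => (ecost a).+1
  | CStore a1 a2 => (ecost a1 + ecost a2).+1
  | CSeq c1 c2 => ccost c1 + ccost c2
  | CIfLt a1 a2 c1 c2 => (ecost a1 + ecost a2).+1 + (ccost c1 + ccost c2)
  | CWhileLt a1 a2 c => (ecost a1 + ecost a2).+1 + ccost c
  end.

Definition bounded (V : nat) (s : state) : Prop :=
  (forall r, reg s r <= V) /\ (forall a, mem s a <= V).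

Lemma bounded_le V W s : V <= W -> bounded V s -> bounded W s.
Proof. by move=> VW [br bm]; split=> x; apply: leq_trans VW. Qed.

Lemma upd_le f i x V j : (forall k, f k <= V) -> x <= V -> upd f i x j <= V.
Proof. by move=> fV xV; rewrite /upd; case: ifP. Qed.

Section Exec.
Variables (N k : nat).
Hypothesis N_ge2 : 2 <= N.

Lemma ev_le m s a : bounded (N ^ m) s -> ev s a <= N ^ (m + eweight a).
Proof.
move=> [br bm].
have N0 : 0 < N by lia.
have mono x y : x <= y -> N ^ x <= N ^ y by move=> xy; rewrite leq_pexp2l.
elim: a => [c|r|a _|a IHa b IHb|a IHa b IHb] /=.
- apply: leq_trans (mono c (m + c) (leq_addl _ _)).
  by apply: ltnW; apply: ltn_expl; exact: N_ge2.
- by rewrite addn0.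
- exact: leq_trans (bm _) (mono _ _ (leq_addr _ _)).
- rewrite addnS expnS; apply: leq_trans (leq_mul N_ge2 (leqnn _)).
  rewrite mul2n -addnn; apply: leq_add.
    by apply: leq_trans IHa _; apply: mono; lia.
  by apply: leq_trans IHb _; apply: mono; lia.
- apply: leq_trans (leq_subr _ _) _; apply: leq_trans IHa _; apply: mono; lia.
Qed.

Lemma eval_ev m s a : bounded (N ^ m) s -> m + eweight a < k ->
  eval (N ^ k) s a = Some (ev s a).
Proof.
move=> bs; have wordE x w : x <= N ^ (m + w) -> m + w < k -> word (N ^ k) x = Some x.
  move=> xw wk; rewrite /word (leq_ltn_trans xw) // ltn_exp2l //.
have lt := @ev_le m s _ bs.
elim: a => [c|r|a IHa|a IHa b IHb|a IHa b IHb] /= ak.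
- by apply: wordE ak; exact: (lt (EConst c)).
- by apply: wordE ak; exact: (lt (EReg r)).
- by rewrite IHa //; apply: wordE ak; exact: (lt (ELoad a)).
- rewrite IHa ?IHb; try lia.
  by apply: wordE ak; exact: (lt (EAdd a b)).
- rewrite IHa ?IHb; try lia.
  by apply: wordE ak; exact: (lt (ESub a b)).
Qed.

Lemma sem_exec c m s : loop_free c -> bounded (N ^ m) s -> m + cweight c < k ->
  (exists2 t, t <= ccost c & exec (N ^ k) c s t (sem c s)) /\
  bounded (N ^ (m + cweight c)) (sem c s).
Proof.
have N0 : 0 < N by lia.
have mono x y : x <= y -> N ^ x <= N ^ y by move=> xy; rewrite leq_pexp2l.
elim: c m s => [|r a|a b|c1 IH1 c2 IH2|a b c1 IH1 c2 IH2|] //= m s.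
- move=> _ bs _; split; first by exists 1 => //; exact: ExSkip.
  by apply: bounded_le bs; rewrite addn0.
- move=> _ bs mk; split; first by eexists; last exact: ExSet (eval_ev bs mk).
  case: (bounded_le (mono m (m + eweight a) (leq_addr _ _)) bs) => br bm.
  by split=> //= x; apply: upd_le => //; exact: ev_le.
- move=> _ bs mk; split.
    by eexists; last apply: ExStore (eval_ev bs _) (eval_ev bs _); lia.
  case: (bounded_le (mono m (m + (eweight a + eweight b)) (leq_addr _ _)) bs) => br bm.
  split=> //= x; apply: upd_le => //; apply: leq_trans (ev_le _ bs) _.
  by apply: mono; lia.
- move=> /andP[l1 l2] bs mk.
  case: (IH1 m s l1 bs); first lia; move=> [t1 le1 ex1] b1.
  case: (IH2 _ _ l2 b1); first lia; move=> [t2 le2 ex2]; rewrite -addnA => b2.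
  by split=> //; exists (t1 + t2); [exact: leq_add | exact: ExSeq ex1 ex2].
- move=> /andP[l1 l2] bs mk.
  have ea : eval (N ^ k) s a = Some (ev s a) by apply: eval_ev bs _; lia.
  have eb : eval (N ^ k) s b = Some (ev s b) by apply: eval_ev bs _; lia.
  case: ltnP => lt.
    case: (IH1 m s l1 bs); first lia; move=> [t1 le1 ex1] b1; split.
      exists ((ecost a + ecost b).+1 + t1); first lia.
      by apply: (ExIf ea eb); rewrite lt.
    by apply: bounded_le b1; apply: mono; lia.
  case: (IH2 m s l2 bs); first lia; move=> [t1 le1 ex1] b1; split.
    exists ((ecost a + ecost b).+1 + t1); first lia.
    by apply: (ExIf ea eb); rewrite ltnNge lt.
  by apply: bounded_le b1; apply: mono; lia.
Qed.

Definition for_to (r r0 : nat) (body : cmd) := CWhileLt (EReg r) (EReg r0) body.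

(** The invariant restores the same bound [N ^ m] after every round; otherwise the weights would add
    up over [n] rounds and no fixed exponent would suffice. *)
Lemma for_exec n m r r0 body (Inv : nat -> state -> Prop) s :
  loop_free body -> m + cweight body < k ->
  (forall i s, Inv i s -> [/\ reg s r = i, reg s r0 = n & bounded (N ^ m) s]) ->
  (forall i s, i < n -> Inv i s -> Inv i.+1 (sem body s)) ->
  Inv 0 s -> exists t s', [/\ exec (N ^ k) (for_to r r0 body) s t s',
    t <= n * (ccost body + 3) + 3 & Inv n s'].
Proof.
move=> lf mk invP step inv0.
suff: forall j i s, i + j = n -> Inv i s -> exists t s',
    [/\ exec (N ^ k) (for_to r r0 body) s t s', t <= j * (ccost body + 3) + 3 & Inv n s'].
  by move=> /(_ n 0 s erefl inv0).
have evr i s' : Inv i s' -> eval (N ^ k) s' (EReg r) = Some i /\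
    eval (N ^ k) s' (EReg r0) = Some n.
  move=> /invP[ri r0n bs].
  by rewrite !(eval_ev bs) /= ?addn0 ?ri ?r0n //; lia.
elim=> [|j IH] i s' ij inv.
  rewrite addn0 in ij; rewrite ij in inv; case: (evr _ _ inv) => e1 e2.
  by exists 3, s'; split=> //; apply: (ExWhileEnd _ e1 e2); rewrite ltnn.
have lt : i < n by lia.
case: (evr _ _ inv) => e1 e2; case: (invP _ _ inv) => _ _ bs.
case: (sem_exec lf bs mk) => -[t1 le1 ex1] _.
case: (IH i.+1 (sem body s')); [lia | exact: step | move=> t2 [s2 [ex2 le2 leaf_inv]]].
exists ((ecost (EReg r) + ecost (EReg r0)).+1 + (t1 + t2)), s2; split=> //.
  exact: ExWhileStep e1 e2 lt ex1 ex2.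
by rewrite /= mulSn; lia.
Qed.

End Exec.

(* Scratch field [j < 16] of vertex [v], above the input and output cells:
   0 degree, 1 sum of the neighbours, 2 width minus 2, 3 width of the heavy child
   (0 if there is none), 4 heavy child, 5 pruning queue (indexed by position),
   6 abscissa, 7 next free abscissa for a light child, 8 light depth. *)
Definition adr (n j v : nat) := 4 * n + 16 * v + j.

Definition field (m : nat -> nat) (n j : nat) : nat -> nat := fun v => m (adr n j v).

Lemma field_upd m n j v x j' : j < 16 -> j' < 16 ->
  field (upd m (adr n j v) x) n j' =
  if j' == j then upd (field m n j') v x else field m n j'.
Proof.
move=> j16 j'16; apply: funext => w; rewrite /field /upd /adr.
have -> : (4 * n + 16 * w + j' == 4 * n + 16 * v + j) = (j' == j) && (w == v) by lia.
by case: (j' == j).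
Qed.

Lemma field_upd_low m n a x j : a < 4 * n ->
  field (upd m a x) n j = field m n j.
Proof.
move=> an; apply: funext => w; rewrite /field /upd /adr.
by have -> : (4 * n + 16 * w + j == a) = false by lia.
Qed.

Lemma upd_low m n j v x a : a < 4 * n -> upd m (adr n j v) x a = m a.
Proof.
move=> an; rewrite /upd /adr.
by have -> : (a == 4 * n + 16 * v + j) = false by lia.
Qed.

(** The machine cannot multiply; the strides 4 and 16 are powers of two, so doublings suffice. *)
Definition dbl a := EAdd a a.
Definition cell j a :=
  EAdd (EAdd (dbl (dbl (EReg 0))) (dbl (dbl (dbl (dbl a))))) (EConst j).
Definition fld j a := ELoad (cell j a).

Lemma ev_cell s j a : ev s (cell j a) = adr (reg s 0) j (ev s a).
Proof. by rewrite /cell /dbl /adr /=; lia. Qed.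

Lemma ev_fld s j a : ev s (fld j a) = field (mem s) (reg s 0) j (ev s a).
Proof. by rewrite /field -ev_cell. Qed.

Arguments cell : simpl never.
Arguments fld : simpl never.
Arguments adr : simpl never.
Arguments field : simpl never.
Arguments upd : simpl never.

Lemma updE f i x j : upd f i x j = if j == i then x else f j.
Proof. by []. Qed.

(** * Symbolic execution and the program text *)

Local Notation "c1 ;; c2" := (CSeq c1 c2) (at level 70, right associativity).

Lemma sem_seqE c1 c2 s : sem (c1 ;; c2) s = sem c2 (sem c1 s).
Proof. by []. Qed.

Lemma sem_setE r a c f m x : ev (State f m) a = x ->
  sem (CSet r a ;; c) (State f m) = sem c (State (upd f r x) m).
Proof. by move=> /= ->. Qed.

Lemma sem_storeE a1 a2 c f m i x : ev (State f m) a1 = i -> ev (State f m) a2 = x ->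
  sem (CStore a1 a2 ;; c) (State f m) = sem c (State f (upd m i x)).
Proof. by move=> /= -> ->. Qed.

Lemma sem_ifE a1 a2 c1 c2 f m x y : ev (State f m) a1 = x -> ev (State f m) a2 = y ->
  sem (CIfLt a1 a2 c1 c2) (State f m) =
  if x < y then sem c1 (State f m) else sem c2 (State f m).
Proof. by move=> /= -> ->. Qed.

Arguments sem : simpl never.

(* Registers 1, 2, 3, 5 are the counters of the four loops and register 4 is the
   length of the queue; 6 holds the current vertex and 7 its parent. *)
Definition tally_body :=
  CSet 6 (ELoad (dbl (EReg 1))) ;;
  CSet 7 (ELoad (EAdd (dbl (EReg 1)) (EConst 1))) ;;
  CStore (cell 0 (EReg 6)) (EAdd (fld 0 (EReg 6)) (EConst 1)) ;;
  CStore (cell 1 (EReg 6)) (EAdd (fld 1 (EReg 6)) (EReg 7)) ;;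
  CStore (cell 0 (EReg 7)) (EAdd (fld 0 (EReg 7)) (EConst 1)) ;;
  CStore (cell 1 (EReg 7)) (EAdd (fld 1 (EReg 7)) (EReg 6)) ;;
  CSet 1 (EAdd (EReg 1) (EConst 1)) ;;
  CSkip.

(** A push without branching: the vertex is always written behind the queue, and the length grows by
    [2 - deg], which is 1 at a leaf and 0 elsewhere because no degree is 0. *)
Definition leaf_body :=
  CStore (cell 5 (EReg 4)) (EReg 2) ;;
  CSet 4 (EAdd (EReg 4) (ESub (EConst 2) (fld 0 (EReg 2)))) ;;
  CSet 2 (EAdd (EReg 2) (EConst 1)) ;;
  CSkip.

(* The increment of register 4 is 1 if register 8 holds 1, and 0 otherwise. *)
Definition prune_body :=
  CSet 6 (fld 5 (EReg 3)) ;;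
  CSet 7 (fld 1 (EReg 6)) ;;
  CSet 8 (ESub (fld 0 (EReg 7)) (EConst 1)) ;;
  CSet 9 (EAdd (fld 2 (EReg 6)) (EConst 2)) ;;
  CStore (cell 0 (EReg 7)) (EReg 8) ;;
  CStore (cell 1 (EReg 7)) (ESub (fld 1 (EReg 7)) (EReg 6)) ;;
  CStore (cell 5 (EReg 4)) (EReg 7) ;;
  CStore (cell 2 (EReg 7)) (EAdd (fld 2 (EReg 7)) (EReg 9)) ;;
  CSet 4 (EAdd (EReg 4) (ESub (ESub (ESub (EConst 2) (EReg 8))
                                (ESub (EConst 1) (EReg 8))) (ESub (EConst 1) (EReg 8)))) ;;
  CSet 3 (EAdd (EReg 3) (EConst 1)) ;;
  CIfLt (fld 3 (EReg 7)) (EReg 9)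
    (CStore (cell 3 (EReg 7)) (EReg 9) ;; CStore (cell 4 (EReg 7)) (EReg 6) ;; CSkip)
    CSkip.

(** Equality with the heavy child is tested by the sum of the two truncated differences. Register 10
    is then reused to pass the heavy bit to [output_body]. *)
Definition coord_body :=
  CSet 6 (fld 5 (ESub (ESub (EReg 0) (EReg 5)) (EConst 1))) ;;
  CSet 7 (fld 1 (EReg 6)) ;;
  CSet 5 (EAdd (EReg 5) (EConst 1)) ;;
  CSet 10 (EAdd (ESub (fld 4 (EReg 7)) (EReg 6)) (ESub (EReg 6) (fld 4 (EReg 7)))) ;;
  CIfLt (EReg 10) (EConst 1)
    (CSet 8 (ESub (EAdd (fld 6 (EReg 7)) (EAdd (fld 2 (EReg 7)) (EConst 2)))
                  (fld 3 (EReg 7))) ;;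
     CSet 9 (fld 8 (EReg 7)) ;;
     CSet 10 (EConst 1) ;;
     CSkip)
    (CSet 8 (fld 7 (EReg 7)) ;;
     CSet 9 (EAdd (fld 8 (EReg 7)) (EConst 1)) ;;
     CSet 10 (EConst 0) ;;
     CStore (cell 7 (EReg 7)) (EAdd (EReg 8) (EAdd (fld 2 (EReg 6)) (EConst 2))) ;;
     CSkip).

(** In truncated arithmetic [a + (1 - a)] is [maxn 1 a]. The output overwrites the edge list, which
    is no longer read after the tally. *)
Definition output_body :=
  CStore (cell 6 (EReg 6)) (EReg 8) ;;
  CStore (cell 7 (EReg 6)) (EAdd (EReg 8) (EConst 2)) ;;
  CStore (cell 8 (EReg 6)) (EReg 9) ;;
  CStore (dbl (dbl (EReg 6))) (EReg 8) ;;
  CStore (EAdd (dbl (dbl (EReg 6))) (EConst 1)) (EAdd (dbl (EReg 9)) (EReg 10)) ;;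
  CStore (EAdd (dbl (dbl (EReg 6))) (EConst 2))
    (ESub (EAdd (EReg 8) (EAdd (fld 2 (EReg 6)) (EConst 2)))
          (EAdd (fld 3 (EReg 6)) (ESub (EConst 1) (fld 3 (EReg 6))))) ;;
  CStore (EAdd (dbl (dbl (EReg 6))) (EConst 3)) (EAdd (dbl (EReg 9)) (EConst 2)) ;;
  CSkip.

(** * Effects of the loop bodies *)

Lemma ev_add s a b : ev s (EAdd a b) = ev s a + ev s b. Proof. by []. Qed.
Lemma ev_sub s a b : ev s (ESub a b) = ev s a - ev s b. Proof. by []. Qed.
Lemma ev_const s k : ev s (EConst k) = k. Proof. by []. Qed.
Lemma ev_reg s r : ev s (EReg r) = reg s r. Proof. by []. Qed.

Ltac ev_simpl :=
  rewrite ?(ev_fld, ev_cell, ev_add, ev_sub, ev_const, ev_reg) /= ?updE /=.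

Section Effects.
Variables (f m : nat -> nat) (n : nat).
Hypothesis f0 : f 0 = n.

Lemma tally_body_effect i x y : f 1 = i -> m (2 * i) = x -> m (2 * i + 1) = y -> x != y ->
  sem tally_body (State f m) =
    State (upd (upd (upd f 6 x) 7 y) 1 (i + 1))
      (upd (upd (upd (upd m (adr n 0 x) (field m n 0 x + 1))
        (adr n 1 x) (field m n 1 x + y)) (adr n 0 y) (field m n 0 y + 1))
        (adr n 1 y) (field m n 1 y + x)).
Proof.
move=> f1 mx my xy; rewrite /tally_body.
have yx : (y == x) = false by rewrite eq_sym (negPf xy).
rewrite (@sem_setE _ _ _ _ _ x); last by rewrite /= f1 addnn -mul2n.
rewrite (@sem_setE _ _ _ _ _ y); last by rewrite /= !updE /= f1 addnn -mul2n.
rewrite (@sem_storeE _ _ _ _ _ (adr n 0 x) (field m n 0 x + 1));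
  [|by ev_simpl; rewrite ?f0..].
rewrite (@sem_storeE _ _ _ _ _ (adr n 1 x) (field m n 1 x + y));
  [|by ev_simpl; rewrite ?f0 ?field_upd..].
rewrite (@sem_storeE _ _ _ _ _ (adr n 0 y) (field m n 0 y + 1));
  [|by ev_simpl; rewrite ?f0 ?field_upd //= ?updE ?yx..].
rewrite (@sem_storeE _ _ _ _ _ (adr n 1 y) (field m n 1 y + x));
  [|by ev_simpl; rewrite ?f0 ?field_upd //= ?updE ?yx..].
by rewrite (@sem_setE _ _ _ _ _ (i + 1)); last by ev_simpl; rewrite f1.
Qed.

Lemma leaf_body_effect i t : f 2 = i -> f 4 = t ->
  sem leaf_body (State f m) =
    State (upd (upd f 4 (t + (2 - field m n 0 i))) 2 (i + 1)) (upd m (adr n 5 t) i).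
Proof.
move=> f2 f4; rewrite /leaf_body.
rewrite (@sem_storeE _ _ _ _ _ (adr n 5 t) i); [|by ev_simpl; rewrite ?f0 ?f4..].
rewrite (@sem_setE _ _ _ _ _ (t + (2 - field m n 0 i))); last first.
  by ev_simpl; rewrite ?f0 f4 f2 field_upd.
by rewrite (@sem_setE _ _ _ _ _ (i + 1)); last by ev_simpl; rewrite f2.
Qed.

Lemma prune_body_effect i t v p z D : f 3 = i -> f 4 = t -> field m n 5 i = v ->
  field m n 1 v = p -> z = field m n 2 v + 2 -> D = field m n 0 p - 1 ->
  let m' := upd (upd (upd (upd m (adr n 0 p) D) (adr n 1 p) (field m n 1 p - v))
              (adr n 5 t) p) (adr n 2 p) (field m n 2 p + z) in
  sem prune_body (State f m) =
    State (upd (upd (upd (upd (upd (upd f 6 v) 7 p) 8 D) 9 z) 4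
            (t + (2 - D - (1 - D) - (1 - D)))) 3 (i + 1))
          (if field m n 3 p < z
           then upd (upd m' (adr n 3 p) z) (adr n 4 p) v else m').
Proof.
move=> f3 f4 Fv Fp zE DE m'; rewrite /prune_body.
rewrite (@sem_setE _ _ _ _ _ v); last by ev_simpl; rewrite ?f0 f3.
rewrite (@sem_setE _ _ _ _ _ p); last by ev_simpl; rewrite ?f0.
rewrite (@sem_setE _ _ _ _ _ D); last by ev_simpl; rewrite ?f0.
rewrite (@sem_setE _ _ _ _ _ z); last by ev_simpl; rewrite ?f0.
rewrite (@sem_storeE _ _ _ _ _ (adr n 0 p) D); [|by ev_simpl; rewrite ?f0..].
rewrite (@sem_storeE _ _ _ _ _ (adr n 1 p) (field m n 1 p - v));
  [|by ev_simpl; rewrite ?f0 ?field_upd..].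
rewrite (@sem_storeE _ _ _ _ _ (adr n 5 t) p); [|by ev_simpl; rewrite ?f0 ?f4..].
rewrite (@sem_storeE _ _ _ _ _ (adr n 2 p) (field m n 2 p + z));
  [|by ev_simpl; rewrite ?f0 ?field_upd..].
rewrite (@sem_setE _ _ _ _ _ (t + (2 - D - (1 - D) - (1 - D)))); last first.
  by ev_simpl; rewrite f4.
rewrite (@sem_setE _ _ _ _ _ (i + 1)); last by ev_simpl; rewrite f3.
rewrite (@sem_ifE _ _ _ _ _ _ (field m n 3 p) z) -/m'; first last.
- by ev_simpl.
- by ev_simpl; rewrite ?f0 !field_upd.
case: ifP => _ //.
rewrite (@sem_storeE _ _ _ _ _ (adr n 3 p) z); [|by ev_simpl; rewrite ?f0..].
by rewrite (@sem_storeE _ _ _ _ _ (adr n 4 p) v); [|by ev_simpl; rewrite ?f0..].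
Qed.

Lemma coord_body_effect j v p : f 5 = j -> field m n 5 (n - j - 1) = v ->
  field m n 1 v = p ->
  let hv := field m n 4 p == v in
  let x := if hv then field m n 6 p + (field m n 2 p + 2) - field m n 3 p
           else field m n 7 p in
  let d := if hv then field m n 8 p else field m n 8 p + 1 in
  sem coord_body (State f m) =
    State (upd (upd (upd (upd (upd (upd (upd f 6 v) 7 p) 5 (j + 1)) 10
            (field m n 4 p - v + (v - field m n 4 p))) 8 x) 9 d) 10 hv)
          (if hv then m else upd m (adr n 7 p) (x + (field m n 2 v + 2))).
Proof.
move=> f5 Fv Fp hv x d; rewrite /coord_body.
rewrite (@sem_setE _ _ _ _ _ v); last by ev_simpl; rewrite ?f0 f5.
rewrite (@sem_setE _ _ _ _ _ p); last by ev_simpl; rewrite ?f0.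
rewrite (@sem_setE _ _ _ _ _ (j + 1)); last by ev_simpl; rewrite f5.
rewrite (@sem_setE _ _ _ _ _ (field m n 4 p - v + (v - field m n 4 p))); last first.
  by ev_simpl; rewrite f0.
rewrite (@sem_ifE _ _ _ _ _ _ (field m n 4 p - v + (v - field m n 4 p)) 1);
  [|by ev_simpl..].
have -> : (field m n 4 p - v + (v - field m n 4 p) < 1) = hv by rewrite /hv; lia.
rewrite /x /d; case: (hv).
  rewrite (@sem_setE _ _ _ _ _ (field m n 6 p + (field m n 2 p + 2) - field m n 3 p));
    last by ev_simpl; rewrite f0.
  rewrite (@sem_setE _ _ _ _ _ (field m n 8 p)); last by ev_simpl; rewrite f0.
  by rewrite (@sem_setE _ _ _ _ _ 1).
rewrite (@sem_setE _ _ _ _ _ (field m n 7 p)); last by ev_simpl; rewrite f0.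
rewrite (@sem_setE _ _ _ _ _ (field m n 8 p + 1)); last by ev_simpl; rewrite f0.
rewrite (@sem_setE _ _ _ _ _ 0) //.
rewrite (@sem_storeE _ _ _ _ _ (adr n 7 p) (field m n 7 p + (field m n 2 v + 2))) //;
  by ev_simpl; rewrite f0.
Qed.

Lemma output_body_effect v x d y : v < n -> f 6 = v -> f 8 = x -> f 9 = d -> f 10 = y ->
  sem output_body (State f m) = State f
    (upd (upd (upd (upd (upd (upd (upd m (adr n 6 v) x) (adr n 7 v) (x + 2))
      (adr n 8 v) d) (4 * v) x) (4 * v + 1) (d + d + y))
      (4 * v + 2) (x + (field m n 2 v + 2) - (field m n 3 v + (1 - field m n 3 v))))
      (4 * v + 3) (d + d + 2)).
Proof.
move=> vn f6 f8 f9 f10; rewrite /output_body.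
have v4 : v + v + (v + v) = 4 * v by lia.
rewrite (@sem_storeE _ _ _ _ _ (adr n 6 v) x); [|by ev_simpl; rewrite ?f0 ?f6..].
rewrite (@sem_storeE _ _ _ _ _ (adr n 7 v) (x + 2));
  [|by ev_simpl; rewrite ?f0 ?f6 ?f8..].
rewrite (@sem_storeE _ _ _ _ _ (adr n 8 v) d); [|by ev_simpl; rewrite ?f0 ?f6..].
rewrite (@sem_storeE _ _ _ _ _ (4 * v) x); [|by rewrite /= ?f6..].
rewrite (@sem_storeE _ _ _ _ _ (4 * v + 1) (d + d + y));
  [|by rewrite /= ?f6 ?f9 ?f10 ?v4..].
rewrite (@sem_storeE _ _ _ _ _ (4 * v + 2) (x + (field m n 2 v + 2) -
  (field m n 3 v + (1 - field m n 3 v)))); first last.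
- have low m' y' i j : i < 4 -> field (upd m' (4 * v + i) y') n j = field m' n j.
    by move=> i4; apply: field_upd_low; lia.
  have low0 m' y' j : field (upd m' (4 * v) y') n j = field m' n j.
    by apply: field_upd_low; lia.
  by ev_simpl; rewrite ?f0 ?f6 ?f8 !low // !low0 !field_upd.
- by rewrite /= f6 v4.
by rewrite (@sem_storeE _ _ _ _ _ (4 * v + 3) (d + d + 2)) //=; rewrite ?f6 ?f9 ?v4.
Qed.

End Effects.

(** * Loop invariants *)

Lemma bounded_reg V f m r x :
  bounded V (State f m) -> x <= V -> bounded V (State (upd f r x) m).
Proof. by move=> [br bm] xV; split=> //= y; exact: upd_le. Qed.

Lemma bounded_mem V f m a x :
  bounded V (State f m) -> x <= V -> bounded V (State f (upd m a x)).
Proof. by move=> [br bm] xV; split=> //= y; exact: upd_le. Qed.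

Definition flat_pairs (l : seq (nat * nat)) := flatten [seq [:: p.1; p.2] | p <- l].

Lemma nth_flat_pairs l i :
  nth 0 (flat_pairs l) (2 * i) = (nth (0, 0) l i).1 /\
  nth 0 (flat_pairs l) (2 * i + 1) = (nth (0, 0) l i).2.
Proof.
elim: l i => [|p l IH] [|i] //; rewrite ?nth_nil //.
have -> : 2 * i.+1 = (2 * i).+2 by lia.
exact: IH.
Qed.

Definition deg_of (l : seq (nat * nat)) (v : nat) :=
  \sum_(p <- l) ((p.1 == v) + (p.2 == v)).
Definition nbr_sum (l : seq (nat * nat)) (v : nat) :=
  \sum_(p <- l) ((p.1 == v) * p.2 + (p.2 == v) * p.1).

Lemma deg_of_rcons l p v : deg_of (rcons l p) v = deg_of l v + ((p.1 == v) + (p.2 == v)).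
Proof. by rewrite /deg_of -cats1 big_cat big_seq1. Qed.

Lemma nbr_sum_rcons l p v :
  nbr_sum (rcons l p) v = nbr_sum l v + ((p.1 == v) * p.2 + (p.2 == v) * p.1).
Proof. by rewrite /nbr_sum -cats1 big_cat big_seq1. Qed.

Lemma deg_of_le l v : deg_of l v <= 2 * size l.
Proof.
elim/last_ind: l => [|l p IH]; first by rewrite /deg_of big_nil.
by rewrite deg_of_rcons size_rcons; lia.
Qed.

Lemma nbr_sum_le n l v : all (fun p => (p.1 <= n) && (p.2 <= n)) l ->
  nbr_sum l v <= 2 * n * size l.
Proof.
elim/last_ind: l => [|l p IH]; first by rewrite /nbr_sum big_nil.
rewrite all_rcons nbr_sum_rcons size_rcons => /andP[/andP[p1 p2] /IH].
by case: (p.1 == v); case: (p.2 == v); rewrite ?mul1n ?mul0n; lia.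
Qed.

(** The quadratic bound is for the neighbour sums; [8 <= (n + 2) ^ 3] absorbs the constant, which
    makes the exponent 5. *)
Lemma word_bound n x : x <= 8 * (n + 2) * (n + 2) -> x <= (n + 2) ^ 5.
Proof.
move=> /leq_trans; apply.
have -> : (n + 2) ^ 5 = (n + 2) ^ 3 * (n + 2) * (n + 2) by rewrite -!expnSr.
have n8 : 2 ^ 3 <= (n + 2) ^ 3 by rewrite leq_exp2r // leq_addl.
by rewrite !leq_mul // n8.
Qed.

Lemma word_bound_linear n x : x <= 8 * n + 16 -> x <= (n + 2) ^ 5.
Proof. by move=> h; apply: word_bound; nia. Qed.

Section SizesAndCoordinates.
Variables (n : nat) (par dep : nat -> nat).
Hypothesis rt : rooted n par dep.

Let V := (n + 2) ^ 5.

Record prune_loop_inv (i : nat) (s : state) : Prop := PruneLoopInv {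
  prune_loop_main : [/\ reg s 3 = i, reg s 0 = n & bounded V s];
  prune_loop_reg5 : reg s 5 = 0;
  prune_loop_queue : exists2 q, reg s 4 = size q &
    prune_inv n par q i (field (mem s) n 5) (field (mem s) n 0) (field (mem s) n 1)
      (fun v => field (mem s) n 2 v + 2) (field (mem s) n 3) (field (mem s) n 4);
  prune_loop_zero : forall j, 6 <= j < 9 -> field (mem s) n j = fun=> 0 }.

Lemma prune_loop_step i s : i < n ->
  prune_loop_inv i s -> prune_loop_inv i.+1 (sem prune_body s).
Proof.
case: s => f m i_lt [] /= [f3 f0 bs] f5 [q f4 inv] zero.
set v := field m n 5 i; have smv := prune_parent rt inv i_lt.
have [vn _ _ _] := prune_head rt inv i_lt.
have [pn _ _] := prune_parent_open rt inv i_lt.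
have := prune_step rt inv i_lt; rewrite -/v in smv vn pn *.
set p := par v in smv pn *.
set q' := (if _ == 1 then _ else _) => inv'.
rewrite (prune_body_effect f0 f3 f4 erefl smv erefl erefl) -/v -/p.
set D := field m n 0 p - 1; set z := field m n 2 v + 2.
have Vn x : x <= 2 * n + 2 -> x <= V by move=> xn; apply: word_bound_linear; lia.
have memV j w : field m n j w <= V by case: bs => _; apply.
(* [D] can be 0, for the virtual parent; the two terms [1 - D] then cancel the 2, so the length
   grows for [D = 1] only. *)
have size_q' : size q + (2 - D - (1 - D) - (1 - D)) = size q'.
  rewrite /q' updE eqxx -/D; case: eqP => [->|D1]; first by rewrite size_rcons addn1.
  lia.
have q'n : size q' <= n.
  rewrite -[n](size_iota 0); apply: uniq_leq_size; first exact: (q_uniq inv').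
  by move=> w /(q_lt inv'); rewrite mem_iota.
have zn : z <= 2 * n + 2 by have := S_le inv (ltnW vn); rewrite /z; lia.
have Spn : field m n 2 p + z <= 2 * n + 2.
  by have := S_le inv' pn; rewrite updE eqxx /z; lia.
have SE' : (fun w => upd (field m n 2) p (field m n 2 p + z) w + 2) =
    upd (fun w => field m n 2 w + 2) p (field m n 2 p + 2 + (field m n 2 v + 2)).
  by apply: funext => w; rewrite !updE /z; case: ifP => // _; lia.
rewrite size_q'.
have DV : D <= V by apply: leq_trans (leq_subr _ _) (memV _ _).
have sV : field m n 1 p - v <= V by apply: leq_trans (leq_subr _ _) (memV _ _).
split=> /=.
- split; rewrite ?updE //=; first lia.
  case: ifP => _; do ?(apply: bounded_mem; last by [|apply: Vn; lia]);
  by do ?(apply: bounded_reg; last by [|apply: Vn; lia]).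
- by rewrite !updE.
- exists q'; first by rewrite !updE.
  move: inv'; rewrite -SE' -/z -/D.
  by case: ltnP => _; rewrite !field_upd.
- move=> j jj; have [j16 j0] : j < 16 /\ 4 < j by lia.
  by case: ifP => _; rewrite !field_upd //= !gtn_eqF ?zero //; lia.
Qed.

(** Fields 0 to 5 no longer change, so the final pruning invariant is carried along and specifies
    parents, widths and heavy children. The output is claimed for placed vertices only, as other low
    cells may still hold edges. *)
Record coord_inv (j : nat) (s : state) : Prop := CoordInv {
  coord_main : [/\ reg s 5 = j, reg s 0 = n & bounded V s];
  coord_queue : exists q,
    [/\ prune_inv n par q n (field (mem s) n 5) (field (mem s) n 0) (field (mem s) n 1)
          (fun v => field (mem s) n 2 v + 2) (field (mem s) n 3) (field (mem s) n 4),
        place_inv n par q (fun v => field (mem s) n 2 v + 2) (field (mem s) n 3)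
          (field (mem s) n 4) j (field (mem s) n 6) (field (mem s) n 7)
          (field (mem s) n 8) &
        forall v, v \in drop (n - j) q ->
          [/\ mem s (4 * v) = field (mem s) n 6 v,
              mem s (4 * v + 1) =
                2 * field (mem s) n 8 v + (field (mem s) n 4 (par v) == v),
              mem s (4 * v + 2) = field (mem s) n 6 v + (field (mem s) n 2 v + 2) -
                maxn 1 (field (mem s) n 3 v) &
              mem s (4 * v + 3) = 2 * field (mem s) n 8 v + 2]] }.

(** The abscissa and depth of [n] are the zeros already in memory; only its free abscissa must be
    written. *)
Definition init_top := CStore (cell 7 (EReg 0)) (EConst 2) ;; CSkip.

Lemma prune_to_coord s : prune_loop_inv n s -> coord_inv 0 (sem init_top s).
Proof.
case: s => f m [] /= [f3 f0 bs] f5 [q f4 inv] zero.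
rewrite /init_top (@sem_storeE _ _ _ _ _ (adr n 7 n) 2) //; last by rewrite ev_cell /= f0.
split=> /=; first by split=> //; apply: bounded_mem => //; apply: word_bound_linear; lia.
exists q; rewrite !field_upd //= (zero 6) // (zero 7) // (zero 8) //; split=> //;
  first exact: place_init inv.
by move=> v; rewrite subn0 drop_oversize // (size_queue inv).
Qed.

Lemma coord_inv_step j s : j < n ->
  coord_inv j s -> coord_inv j.+1 (sem (coord_body ;; output_body) s).
Proof.
case: s => f m j_lt [] /= [f5 f0 bs] [q [fin inv out]].
set v := nth 0 q (n - j - 1).
have [vn vD dropE _] := place_head rt fin j_lt; rewrite -/v in vn vD dropE.
set p := par v; have pn : p <= n := par_le rt vn.
have Fv : field m n 5 (n - j - 1) = v by rewrite (q_ord fin) // (size_queue fin); lia.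
have Fp : field m n 1 v = p.
  rewrite (smE fin) ?(ltnW vn) // vn mul1n (take_queue fin) /open_sum.
  rewrite big_seq_cond big_pred0 ?addn0 // => c.
  by rewrite mem_iota add0n /= (mem_queue fin) andbN.
have inv' := place_step rt fin inv j_lt; have slot := light_slot rt fin inv j_lt.
move: inv' slot; rewrite -/v -/p.
rewrite sem_seqE (coord_body_effect f0 f5 Fv Fp) /=.
set hv := field m n 4 p == v.
set x := if hv then _ else field m n 7 p.
set d := if hv then _ else field m n 8 p + 1 => inv' slot.
have Vn y : y <= 4 * n + 10 -> y <= V by move=> yn; apply: word_bound_linear; lia.
have memV i w : field m n i w <= V by case: bs => _; apply.
have xle : x + (field m n 2 v + 2) <= 2 * n.+1.
  by have := X_le inv' (ltnW vn); rewrite updE eqxx.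
have dle : d <= n.
  have := d_le inv' (ltnW vn); rewrite updE eqxx /d; case: (hv) => h; lia.
set m1 := if hv then m else _.
have m1F i : i < 16 -> i != 7 -> field m1 n i = field m n i.
  by move=> i16 i7; rewrite /m1; case: (hv) => //; rewrite field_upd // (negPf i7).
have m1low a : a < 4 * n -> m1 a = m a.
  by move=> an; rewrite /m1; case: (hv) => //; rewrite upd_low.
have m1F7 : field m1 n 7 = if hv then field m n 7
    else upd (field m n 7) p (field m n 7 p + (field m n 2 v + 2)).
  by rewrite /m1 /x; case: (hv) => //; rewrite field_upd.
set f1 := upd _ 10 hv.
have f1_0 : f1 0 = n by rewrite /f1 !updE.
rewrite (@output_body_effect f1 m1 n f1_0 v x d hv vn) ?/f1 ?updE //.
set m2 := upd _ (4 * v + 3) _.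
have low m' y i k : i < 4 -> field (upd m' (4 * v + i) y) n k = field m' n k.
  by move=> i4; apply: field_upd_low; lia.
have low0 m' y k : field (upd m' (4 * v) y) n k = field m' n k.
  by apply: field_upd_low; lia.
have m2F i : i < 6 -> field m2 n i = field m n i.
  move=> i6; have i16 : i < 16 by lia.
  rewrite /m2 !low // low0 !field_upd // !ltn_eqF ?m1F //; lia.
have m2F6 : field m2 n 6 = upd (field m n 6) v x.
  by rewrite /m2 !low // low0 !field_upd //= m1F.
have m2F7 : field m2 n 7 = upd (field m1 n 7) v (x + 2).
  by rewrite /m2 !low // low0 !field_upd.
have m2F8 : field m2 n 8 = upd (field m n 8) v d.
  by rewrite /m2 !low // low0 !field_upd //= m1F.
split=> /=.
- split; rewrite ?updE //=; first lia.
  rewrite /m2 !m1F //; have hv1 : hv <= 1 by case: (hv).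
  have bm1 g : bounded V (State g m) -> bounded V (State g m1).
    move=> bg; rewrite /m1; case: (hv) => //.
    by apply: bounded_mem => //; apply: Vn; lia.
  do 7 (apply: bounded_mem; last by apply: Vn; lia); apply: bm1.
  do 3 (apply: bounded_reg; last by apply: Vn; lia).
  apply: bounded_reg; last by have := memV 4 p; have := Vn v; lia.
  by do 3 (apply: bounded_reg; last by apply: Vn; lia).
exists q; rewrite (m2F 0) // (m2F 1) // (m2F 2) // (m2F 3) // (m2F 4) // (m2F 5) //
  m2F6 m2F7 m2F8 m1F7; split=> //.
  by rewrite /d addn1; exact: inv'.
move=> w; rewrite dropE inE => /predU1P[->|wD].
  rewrite !updE eqxx /m2 !updE -/p -/hv !m1F //.
  have c1 a b : (4 * v + a == 4 * v + b) = (a == b) by lia.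
  have c2 b : (4 * v == 4 * v + b) = (0 == b) by lia.
  have c3 b : (4 * v + b == 4 * v) = (b == 0) by lia.
  rewrite !c1 !c2 !c3.
  by rewrite !eqxx /=; split=> //; lia.
have wv : (w == v) = false by apply/eqP => wv; rewrite -wv wD in vD.
have wn : w < n by rewrite -(mem_queue fin) (mem_drop wD).
have m2low i : i < 4 -> m2 (4 * w + i) = m (4 * w + i).
  move=> i4; have a4 : 4 * w + i < 4 * n by lia.
  rewrite -m1low // /m2 !(@updE _ (4 * v + _)) (@updE _ (4 * v)) !(upd_low _ _ _ _ a4).
  by do 4 (case: eqP => [?|_]; first by lia).
have m2low0 : m2 (4 * w) = m (4 * w) by have := m2low 0 isT; rewrite addn0.
by rewrite m2low0 !m2low // !updE wv; exact: out.
Qed.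

End SizesAndCoordinates.

(** * Degrees, neighbour sums and the initial leaves *)

Section DegreesAndLeaves.
Variables (n : nat) (par : nat -> nat).
Variable E : seq (nat * nat).
Hypothesis sizeE : size E = n.
Hypothesis E_le : all (fun p => (p.1 <= n) && (p.2 <= n)) E.
Hypothesis E_neq : all (fun p => p.1 != p.2) E.
Hypothesis E_sum : forall F : nat -> nat -> nat, (forall x y, F x y = F y x) ->
  \sum_(p <- E) F p.1 p.2 = \sum_(c <- iota 0 n) F c (par c).

Let V := (n + 2) ^ 5.

Record tally_inv (i : nat) (s : state) : Prop := TallyInv {
  tally_main : [/\ reg s 1 = i, reg s 0 = n & bounded V s];
  tally_regs : [/\ reg s 2 = 0, reg s 3 = 0, reg s 4 = 0 & reg s 5 = 0];
  tally_low : forall a, a < 2 * n -> mem s a = nth 0 (flat_pairs E) a;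
  tally_deg : field (mem s) n 0 = deg_of (take i E);
  tally_sum : field (mem s) n 1 = nbr_sum (take i E);
  tally_zero : forall j, 2 <= j < 16 -> field (mem s) n j = fun=> 0 }.

Lemma tally_inv_step i s : i < n -> tally_inv i s -> tally_inv i.+1 (sem tally_body s).
Proof.
case: s => f m i_lt [] /= [f1 f0 bs] [f2 f3 f4 f5] low degE sumE zero.
set p := nth (0, 0) E i; have [px py] := nth_flat_pairs E i; rewrite -/p in px py.
have pE : p \in E by rewrite mem_nth ?sizeE.
have /andP[p1 p2] := allP E_le p pE; have pneq := allP E_neq p pE.
have takeE : take i.+1 E = rcons (take i E) p by rewrite -take_nth ?sizeE.
have mx : m (2 * i) = p.1 by rewrite low ?px //; lia.
have my : m (2 * i + 1) = p.2 by rewrite low ?py //; lia.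
rewrite (tally_body_effect f0 f1 mx my pneq) degE sumE.
have lei : size (take i E) <= n by rewrite size_take sizeE i_lt ltnW.
have dle v : deg_of (take i E) v + 1 <= V.
  by apply: word_bound_linear; have := deg_of_le (take i E) v; lia.
have sle v w : w <= n -> nbr_sum (take i E) v + w <= V.
  move=> wn; apply: word_bound; have := @nbr_sum_le n (take i E) v.
  have -> : all (fun p => (p.1 <= n) && (p.2 <= n)) (take i E).
    by apply/allP => r /mem_take; exact: (allP E_le).
  by move=> /(_ isT); nia.
split=> /=; rewrite ?takeE.
- split; rewrite ?updE //=; first lia.
  do 4 (apply: bounded_mem; last by auto).
  by do 3 (apply: bounded_reg; last by apply: word_bound_linear; lia).
- by rewrite !updE.
- by move=> a an; rewrite !upd_low ?low //; lia.
- rewrite !field_upd //= degE; apply: funext => w; rewrite deg_of_rcons !updE.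
  case: (w =P p.2) => [->|/eqP w2]; first by rewrite (negPf pneq) eqxx; lia.
  rewrite [p.2 == w]eq_sym (negPf w2).
  by case: (w =P p.1) => [->|/eqP w1]; rewrite ?eqxx // eq_sym (negPf w1) addn0.
- rewrite !field_upd //= sumE; apply: funext => w; rewrite nbr_sum_rcons !updE.
  case: (w =P p.2) => [->|/eqP w2]; first by rewrite (negPf pneq) eqxx; lia.
  rewrite [p.2 == w]eq_sym (negPf w2).
  case: (w =P p.1) => [->|/eqP w1]; first by rewrite eqxx mul1n addn0.
  by rewrite eq_sym (negPf w1) addn0.
- by move=> [|[|j]] // jj; rewrite !field_upd //= zero.
Qed.

Let deg := deg_of E.
Let sm := nbr_sum E.

Lemma degE0 v : v <= n -> deg v = (v < n) + open_sum n [::] (fun c => par c == v).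
Proof.
move=> vn; rewrite /deg /deg_of.
rewrite (E_sum (F := fun x y => (x == v) + (y == v))) ?big_split /=; last first.
  by move=> x y; rewrite addnC.
congr (_ + _); case: ltnP => vn'.
  rewrite (bigD1_seq v) ?mem_iota ?iota_uniq //= eqxx big1 ?addn0 // => c.
  by move=> /negPf ->.
rewrite big_seq big1 // => c; rewrite mem_iota add0n => /= cn.
by apply/eqP; rewrite eqb0; apply/eqP; lia.
Qed.

Lemma smE0 v : v <= n ->
  sm v = (v < n) * par v + open_sum n [::] (fun c => (par c == v) * c).
Proof.
move=> vn; rewrite /sm /nbr_sum.
rewrite (E_sum (F := fun x y => (x == v) * y + (y == v) * x)) ?big_split /=; last first.
  by move=> x y; rewrite addnC.
congr (_ + _); case: ltnP => vn'.
  rewrite (bigD1_seq v) ?mem_iota ?iota_uniq //= eqxx big1 ?addn0 // => c.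
  by move=> /negPf ->.
rewrite big_seq big1 // => c; rewrite mem_iota add0n => /= cn.
by have -> : (c == v) = false by apply/eqP; lia.
Qed.

Let queue i := [seq v <- iota 0 i | deg v == 1].

Record leaf_inv (i : nat) (s : state) : Prop := LeafInv {
  leaf_main : [/\ reg s 2 = i, reg s 0 = n & bounded V s];
  leaf_regs : [/\ reg s 3 = 0, reg s 4 = size (queue i) & reg s 5 = 0];
  leaf_deg : field (mem s) n 0 = deg;
  leaf_sum : field (mem s) n 1 = sm;
  leaf_ord : forall j, j < size (queue i) -> field (mem s) n 5 j = nth 0 (queue i) j;
  leaf_zero : forall j, 2 <= j < 16 -> j != 5 -> field (mem s) n j = fun=> 0 }.

Lemma tally_to_leaf s : tally_inv n s -> leaf_inv 0 s.
Proof.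
move=> [[f1 f0 bs] [f2 f3 f4 f5] low degE sumE zero].
rewrite take_oversize ?sizeE // in degE sumE.
by split=> // j jj _; exact: zero.
Qed.

Lemma leaf_inv_step i s : i < n -> leaf_inv i s -> leaf_inv i.+1 (sem leaf_body s).
Proof.
case: s => f m i_lt [] /= [f2 f0 bs] [f3 f4 f5] degE sumE ordE zero.
rewrite (@leaf_body_effect f m n f0 _ _ f2 f4) degE.
have qE : queue i.+1 = if deg i == 1 then rcons (queue i) i else queue i.
  by rewrite /queue -[i.+1]addn1 iotaD add0n filter_cat /= -cats1; case: ifP; rewrite ?cats0.
have qle : size (queue i) <= i.
  by rewrite size_filter; apply: leq_trans (count_size _ _) _; rewrite size_iota.
(* Thanks to the virtual edge even a single vertex has degree 1, so [2 - deg i] is never 2. *)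
have deg1 : 1 <= deg i by rewrite degE0 ?(ltnW i_lt) // i_lt.
have sizeq : size (queue i) + (2 - deg i) = size (queue i.+1).
  by rewrite qE; case: eqP => [->|]; rewrite ?size_rcons; lia.
split=> /=.
- split; rewrite ?updE //=; first lia.
  apply: bounded_mem; last by apply: word_bound_linear; lia.
  by do 2 (apply: bounded_reg; last by apply: word_bound_linear; lia).
- by rewrite !updE.
- by rewrite field_upd.
- by rewrite field_upd.
- rewrite field_upd //= => j; rewrite updE qE; case: ifP => d1.
    rewrite size_rcons nth_rcons ltnS leq_eqVlt; case: eqP => [->|_ /=].
      by rewrite ltnn.
    by move=> jq; rewrite jq ordE.
  by move=> jq; rewrite ltn_eqF // ordE.
- by move=> j jj j5; rewrite field_upd //=; [rewrite (negPf j5) zero | case/andP: jj].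
Qed.

Lemma leaf_to_prune s : leaf_inv n s -> prune_loop_inv n par 0 s.
Proof.
move=> [[f2 f0 bs] [f3 f4 f5] degE sumE ordE zero].
split=> //; last by move=> j jj; apply: zero; lia.
exists (queue n) => //; rewrite degE sumE !(zero 2) // !(zero 3) //.
by apply: prune_init => //; [exact: degE0 | exact: smE0].
Qed.

End DegreesAndLeaves.

(** The endpoint 0 of the virtual edge is already there: a tree has [n - 1] edges, so cell
    [2 * n - 2] is still zero. *)
Definition add_top_edge := CStore (ESub (dbl (EReg 0)) (EConst 1)) (EReg 0) ;; CSkip.

Definition tree_prog :=
  add_top_edge ;; for_to 1 0 tally_body ;; for_to 2 0 leaf_body ;; for_to 3 0 prune_body ;;
  init_top ;; for_to 5 0 (coord_body ;; output_body).

(** * The complete run *)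

Section Run.
Variables (n : nat) (e : rel 'I_n) (es : seq ('I_n * 'I_n)) (par dep : nat -> nat).
Hypothesis n_gt0 : 0 < n.
Hypothesis irr : irreflexive e.
Hypothesis esP : is_edge_list e es.
Hypothesis rt : rooted n par dep.
Hypothesis eP : forall u v : 'I_n, e u v <-> par u = v \/ par v = u.

Let E := edge_pairs es.

Lemma edge_pairs_sum (F : nat -> nat -> nat) : (forall x y, F x y = F y x) ->
  \sum_(p <- E) F p.1 p.2 = \sum_(c <- iota 0 n) F c (par c).
Proof. exact: (sum_edge_pairs n_gt0 rt eP esP). Qed.

Lemma size_edge_pairs : size E = n.
Proof.
have := @edge_pairs_sum (fun _ _ => 1) (fun _ _ => erefl).
by rewrite !sum1_size size_iota.
Qed.

Lemma edge_pairs_le : all (fun p => (p.1 <= n) && (p.2 <= n)) E.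
Proof.
rewrite /E /edge_pairs all_rcons leqnn leq0n /=; apply/allP => p /mapP[r _ ->] /=.
by rewrite !(ltnW (ltn_ord _)).
Qed.

Lemma edge_pairs_neq : all (fun p => p.1 != p.2) E.
Proof.
rewrite /E /edge_pairs all_rcons /= neq_ltn n_gt0 /=.
apply/allP => p /mapP[r res ->] /=; apply/eqP => /val_inj r12.
case: esP => _ /(_ r.1 r.2)[_ /(_ (map_f _ res))].
by rewrite r12 irr.
Qed.

Lemma flat_input : flatten [seq [:: val p.1; val p.2] | p <- es] =
  flat_pairs [seq (val p.1, val p.2) | p <- es].
Proof. by rewrite /flat_pairs -map_comp. Qed.

Lemma size_flat_pairs l : size (flat_pairs l) = 2 * size l.
Proof. by elim: l => //= p l; rewrite /flat_pairs /= => ->; lia. Qed.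

Lemma input_bounded : bounded ((n + 2) ^ 5) (input_state es).
Proof.
split=> [r|a]; apply: word_bound_linear; rewrite /input_state /=.
  by rewrite /upd; case: ifP => _; lia.
suff : nth 0 (flatten [seq [:: val p.1; val p.2] | p <- es]) a <= n 
  by move=> /leq_trans; apply; lia.
elim: es a => [|p l IH] [|[|a]] //=; rewrite ?nth_nil //; exact: ltnW.
Qed.

Lemma tally_inv_start : tally_inv n E 0 (sem add_top_edge (input_state es)).
Proof.
have := input_bounded; rewrite /input_state flat_input.
have flatE : flat_pairs E = flat_pairs [seq (val p.1, val p.2) | p <- es] ++ [:: 0; n].
  by rewrite /E /edge_pairs /flat_pairs map_rcons -cats1 flatten_cat.
have : size (flat_pairs E) = 2 * n by rewrite size_flat_pairs size_edge_pairs.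
rewrite flatE size_cat; move: (flat_pairs [seq _ | _ <- es]) flatE => l flatE /= sz bs.
rewrite /add_top_edge (@sem_storeE _ _ _ _ _ (2 * n - 1) n); last first.
- by rewrite /= updE.
- by rewrite /= !updE /=; lia.
have zero j : field (upd (nth 0 l) (2 * n - 1) n) n j = fun=> 0.
  rewrite field_upd_low; last lia.
  by apply: funext => v; rewrite /field /adr nth_default //; lia.
split=> /=.
- split=> //; rewrite ?updE //.
  by apply: bounded_mem => //; apply: word_bound_linear; lia.
- by rewrite !updE.
- move=> a an; rewrite updE flatE nth_cat; case: ltnP => h.
    by rewrite ltn_eqF //; lia.
  rewrite nth_default //; case: eqP => [->|ne].
    by have -> : 2 * n - 1 - size l = 1 by lia.
  by have -> : a - size l = 0 by lia.
- by rewrite zero take0; apply: funext => v; rewrite /deg_of big_nil.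
- by rewrite zero take0; apply: funext => v; rewrite /nbr_sum big_nil.
- by move=> j _; exact: zero.
Qed.

Lemma tree_prog_run k : 5 + cweight tree_prog < k ->
  exists t s, [/\ exec ((n + 2) ^ k) tree_prog (input_state es) t s,
    t <= (ccost tree_prog + 30) * n & coord_inv n par n s].
Proof.
have N2 : 2 <= n + 2 by lia.
have wE : cweight tree_prog = cweight add_top_edge + (cweight tally_body + (cweight leaf_body +
  (cweight prune_body + (cweight init_top + cweight (coord_body ;; output_body))))) by [].
have cE : ccost tree_prog = ccost add_top_edge + (3 + ccost tally_body + (3 + ccost leaf_body +
  (3 + ccost prune_body + (ccost init_top + (3 + ccost (coord_body ;; output_body)))))) by [].
rewrite wE cE => wk {wE cE}.
have main1 i s : tally_inv n E i s -> [/\ reg s 1 = i, reg s 0 = n & bounded ((n + 2) ^ 5) s].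
  by case.
have main2 i s : leaf_inv n E i s -> [/\ reg s 2 = i, reg s 0 = n & bounded ((n + 2) ^ 5) s].
  by case.
have main3 i s : prune_loop_inv n par i s -> [/\ reg s 3 = i, reg s 0 = n & bounded ((n + 2) ^ 5) s].
  by case.
have main4 i s : coord_inv n par i s -> [/\ reg s 5 = i, reg s 0 = n & bounded ((n + 2) ^ 5) s].
  by case.
have w0 : 5 + cweight add_top_edge < k by lia.
have w1 : 5 + cweight tally_body < k by lia.
have w2 : 5 + cweight leaf_body < k by lia.
have w3 : 5 + cweight prune_body < k by lia.
have w4 : 5 + cweight init_top < k by lia.
have w5 : 5 + cweight (coord_body ;; output_body) < k by lia.
have [[t0 le0 ex0] _] := sem_exec N2 (isT : loop_free add_top_edge) input_bounded w0.
have [t1 [s1 [ex1 le1 I1]]] := for_exec N2 (isT : loop_free tally_body) w1 main1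
  (tally_inv_step size_edge_pairs edge_pairs_le edge_pairs_neq) tally_inv_start.
have [t2 [s2 [ex2 le2 I2]]] := for_exec N2 (isT : loop_free leaf_body) w2 main2
  (leaf_inv_step size_edge_pairs edge_pairs_le edge_pairs_neq edge_pairs_sum) (tally_to_leaf size_edge_pairs I1).
have [t3 [s3 [ex3 le3 I3]]] := for_exec N2 (isT : loop_free prune_body) w3 main3
  (prune_loop_step rt) (leaf_to_prune size_edge_pairs edge_pairs_le edge_pairs_neq edge_pairs_sum I2).
have [_ _ bs3] := main3 _ _ I3.
have [[t4 le4 ex4] _] := sem_exec N2 (isT : loop_free init_top) bs3 w4.
have [t5 [s5 [ex5 le5 I5]]] := for_exec N2 (isT : loop_free (coord_body ;; output_body)) w5 main4
  (coord_inv_step rt) (prune_to_coord I3).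
exists (t0 + (t1 + (t2 + (t3 + (t4 + t5))))), s5; split=> //.
  exact: ExSeq ex0 (ExSeq ex1 (ExSeq ex2 (ExSeq ex3 (ExSeq ex4 ex5)))).
move: le0 le1 le2 le3 le4 le5 {w0 w1 w2 w3 w4 w5 wk}.
move: (ccost add_top_edge) (ccost tally_body) (ccost leaf_body) (ccost prune_body) (ccost init_top).
move: (ccost (coord_body ;; output_body)) => c5 c0 c1 c2 c3 c4 le0 le1 le2 le3 le4 le5.
have m0 : c0 <= c0 * n by rewrite leq_pmulr.
have m4 : c4 <= c4 * n by rewrite leq_pmulr.
by rewrite !mulnDl; rewrite !(mulnC n) !mulnDl in le1 le2 le3 le5; lia.
Qed.

End Run.

(** The word bound is polynomial in [n], that is, words have a logarithmic number of bits. The area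
    bound starts at two vertices because [trunc_log 2 1] is 0. *)
Theorem theorem6 :
  exists (prog : cmd) (k C : nat),
    forall (R : realType) (n : nat) (e : rel 'I_n) (es : seq ('I_n * 'I_n)),
      is_tree e -> is_edge_list e es ->
      exists (t : nat) (s : state),
        let L := output_layout R (n := n) s in
        [/\ exec ((n + 2) ^ k) prog (input_state es) t s,
            t <= C * n,
            rectangular_layout e L,
            on_integer_grid L
          & 1 < n -> layout_area_le L (C * n * trunc_log 2 n)%:R].
Proof.
(* The invariants bound all words by [(n + 2) ^ 5] and the weight bounds the growth within one pass,
   so the exponent must exceed their sum. The 30 covers the four final loop tests, 12 operations in
   all, and the constant 18 of the area. *)
exists tree_prog, (6 + cweight tree_prog), (ccost tree_prog + 30).
move=> R n e es te esP.
have [par [dep [rt eP]]] := tree_rooted te.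
have n_gt0 : 0 < n by case: te; rewrite card_ord.
have irr : irreflexive e by case: te.
have [|t [s [ex le [_ [q [fin inv out]]]]]] :=
  tree_prog_run n_gt0 irr esP rt eP (k := 6 + cweight tree_prog); first lia.
exists t, s => L.
have pl := place_final rt fin inv.
have LE : L = @placed_rect R n (field (mem s) n 6)
    (fun v => field (mem s) n 2 v + 2) (fun v => maxn 1 (field (mem s) n 3 v))
    (field (mem s) n 8) (fun v => field (mem s) n 4 (par v) == v).
  apply: funext => v; rewrite /L /output_layout /placed_rect /right_of /top_of /bottom_of.
  have vq : val v \in drop (n - n) q.
    by rewrite subnn drop0 (mem_queue fin); exact: ltn_ord.
  by have [-> -> -> ->] := out v vq.
rewrite LE; split=> //.
- exact: (placed_rectangular_layout R rt eP pl).
- exact: placed_on_integer_grid.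
- move=> n1; apply: (placed_area R rt pl) => //.
  + exact: (X_top inv).
  + exact: (S_le fin).
  + exact: (d_top inv).
Qed.
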